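(* Let $\Delta$ be a (compact) polyhedral complex with integral structure and let $\Delta_0\subset\Delta$ be a subcomplex. Let $\Delta_0'$ be a triangulation of $\Delta_0$ induced by a lifting function. Then there exists a triangulation $\Delta'$ of $\Delta$, also induced by a lifting function, which extends $\Delta_0'$ and introduces no new vertices, that is, $\mathrm{Sk}^0(\Delta')=\mathrm{Sk}^0(\Delta)\cup\mathrm{Sk}^0(\Delta_0')$.
   Context: Compact polyhedral complex (in the sense of Kempf–Knudsen–Mumford–Saint-Donat, Toroidal Embeddings I): a topological space $|\Delta|$ with a finite family of closed subsets $\sigma_\alpha$ (cells) and, for each cell, a finite-dimensional real vector space $V_\alpha$ of continuous real functions on $\sigma_\alpha$ containing the constants, such that: a basis $1,f_1,\ldots,f_k$ of $V_\alpha$ gives a homeomorphism $(f_1,\ldots,f_k)$ of $\sigma_\alpha$ onto a compact convex polytope in $\mathbb{R}^k$ not contained in a hyperplane; the preimages of the faces of this polytope are again cells $\sigma_\beta$ (the faces of $\sigma_\alpha$), with $V_\beta=V_\alpha|_{\sigma_\beta}$; and $|\Delta|$ is the disjoint union of the relative interiors of the cells. An integral structure is a choice of finitely generated subgroups $L_\alpha\subset V_\alpha$ with $L_\alpha\otimes\mathbb{R}\cong V_\alpha$, containing a nonzero constant, compatible with restriction to faces, and such that the vertices are rational (elements of $L_\alpha$ take rational values at vertices of $\sigma_\alpha$). All polyhedral complexes are compact and carry an integral structure. (The complex need not embed in any $\mathbb{R}^n$.) A point of $\sigma_\alpha$ is rational if all elements of $L_\alpha$ take rational values there. $\mathrm{Sk}^k(\Delta)$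 is the $k$-skeleton of $\Delta$; in particular $\mathrm{Sk}^0(\Delta)$ is the set of vertices. A subdivision $\Delta'$ of $\Delta$ is a finite (rational) polyhedral decomposition of $\Delta$, each of whose cells is a polytope contained in a cell of $\Delta$, closed under taking faces and with any two cells lying in a common cell of $\Delta$ meeting in a common face, and with $|\Delta'|=|\Delta|$. It is a triangulation (simplicial subdivision) if every cell of $\Delta'$ is a simplex. $\Delta'$ extends a subdivision $\Delta_0'$ of $\Delta_0$ if the restriction of $\Delta'$ to $\Delta_0$ is $\Delta_0'$. A lifting function $f:\Delta\to\mathbb{R}$ is a continuous function on $|\Delta|$ which on each cell is piecewise linear and ''convex down'', i.e. $f(\lambda x+\mu y)\ge\lambda f(x)+\mu f(y)$ for $\lambda,\mu\ge0$, $\lambda+\mu=1$, and which respects the integral structure, taking rational values at rational points. (''Linear'' on a cell means given by an element of $V_\alpha$, i.e. affine.) The subdivision induced by $f$ is the coarsest subdivision of $\Delta$ such that $f$ is linear on each of its cells. Lifting functions on $\Delta_0$ are defined in the same way, with $\Delta_0$ as the complex. *)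

(* Defs.v *)
From HB Require Import structures.
From mathcomp Require Import all_boot all_order all_algebra.
From mathcomp Require Import all_classical all_reals all_analysis.
Import Order.TTheory GRing.Theory Num.Theory.
Import numFieldNormedType.Exports.

Set Implicit Arguments.
Unset Strict Implicit.
Unset Printing Implicit Defensive.

Local Open Scope classical_set_scope.
Local Open Scope ring_scope.

(** A real function on a subset [C] of [T] is represented by any function
    [T -> R] that restricts to it. A set [V] of functions on [C] is a set of
    functions [T -> R] saturated for equality on [C] (see [fun_space_on]). *)
Section FunctionSpaces.
Context {R : realType} {T : Type}.
Implicit Types (C F P : set T) (V L : set (T -> R)).

Definition fun_space_on C V : Prop :=
  [/\ forall f g, V f -> (forall x, C x -> f x = g x) -> V g,
      forall c, V (cst c) &
      forall a f g, V f -> V g -> V (fun x => a * f x + g x)].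

Definition basis_on C V n (e : 'I_n -> T -> R) : Prop :=
  [/\ forall j, V (e j),
      forall f, V f ->
        exists a : 'I_n -> R, forall x, C x -> f x = \sum_j a j * e j x &
      forall a : 'I_n -> R,
        (forall x, C x -> \sum_j a j * e j x = 0) -> forall j, a j = 0].

Definition restrict_to C V : set (T -> R) :=
  [set g | exists2 f, V f & forall x, C x -> g x = f x].

(** [L] is a finitely generated subgroup of [V] such that the natural map
    from [L] tensor [R] to [V] is bijective. Such an [L] is torsion-free,
    hence free, and bijectivity says that a Z-basis of [L] is an R-basis
    of [V]. *)
Definition full_lattice C V L : Prop :=
  exists n (e : 'I_n -> T -> R), basis_on C V e /\
    forall f, L f <->
      exists z : 'I_n -> int, forall x, C x -> f x = \sum_j (z j)%:~R * e j x.

(** Here [V] plays the role of the space of affine functions on [P]. Faces are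
    nonempty, and [P] is a face of itself, cut out by [l = 0]. *)
Definition face_of V F P : Prop :=
  F !=set0 /\
  exists2 l, V l & (forall x, P x -> 0 <= l x) /\ F = P `&` [set x | l x = 0].

Definition weights n (w : 'I_n -> R) : Prop :=
  (forall j, 0 <= w j) /\ \sum_j w j = 1.

(** In affine coordinates given by a basis [1, f_1, ..., f_k] of [V], this
    says that [x] is the combination of the points [p j] with weights [w j]. *)
Definition combination V n (p : 'I_n -> T) (w : 'I_n -> R) (x : T) : Prop :=
  forall f, V f -> f x = \sum_j w j * f (p j).

Definition hull_in C V n (p : 'I_n -> T) : set T :=
  [set x | C x /\ exists2 w : 'I_n -> R, weights w & combination V p w x].

(** As [V] contains the constants, the hypothesis forces [\sum_j c j = 0]. *)
Definition affinely_independent V n (p : 'I_n -> T) : Prop :=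
  forall c : 'I_n -> R, (forall f, V f -> \sum_j c j * f (p j) = 0) ->
    forall j, c j = 0.

End FunctionSpaces.

Section EuclideanPolytopes.
Context {R : realType} {k : nat}.

Definition affine_functions : set ('rV[R]_k -> R) :=
  [set l | exists (a : 'rV[R]_k) (b : R),
     forall x : 'rV[R]_k, l x = b + \sum_j a ord0 j * x ord0 j].

Definition convex_polytope (P : set 'rV[R]_k) : Prop :=
  exists n (p : 'I_n.+1 -> 'rV[R]_k),
    P = [set x | exists2 w, weights w & x = \sum_j w j *: p j].

Definition in_hyperplane (P : set 'rV[R]_k) : Prop :=
  exists (a : 'rV[R]_k) (b : R),
    a != 0 /\ forall x : 'rV[R]_k, P x -> \sum_j a ord0 j * x ord0 j = b.

End EuclideanPolytopes.

Definition homeomorphism_between {T U : topologicalType}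
    (A : set T) (B : set U) (f : T -> U) : Prop :=
  [/\ set_bij A B f, {within A, continuous f} &
      exists g : U -> T,
        {within B, continuous g} /\ forall x, A x -> g (f x) = x].

(** [phi] is the map [(f_1, ..., f_k)] for a basis [1, f_1, ..., f_k] of [V];
    the index [ord0] carries the constant [1]. *)
Definition affine_chart {R : realType} {T : Type} (C : set T)
    (V : set (T -> R)) k (phi : T -> 'rV[R]_k) : Prop :=
  basis_on C V (fun j : 'I_k.+1 =>
    if unlift ord0 j is Some j' then fun x => phi x ord0 j' else cst 1).

Definition relative_interior {R : realType} {T : Type} (C : set T)
    (V : set (T -> R)) : set T :=
  [set x | C x /\ exists k (phi : T -> 'rV[R]_k),
     affine_chart C V phi /\ interior (phi @` C) (phi x)].

Record polyhedral_complex (R : realType) := PolyhedralComplex {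
  pc_space : topologicalType;
  pc_idx : finType;
  pc_cell : pc_idx -> set pc_space;
  pc_affine : pc_idx -> set (pc_space -> R);
  cell_closed : forall i, closed (pc_cell i);
  affine_space : forall i, fun_space_on (pc_cell i) (pc_affine i);
  affine_continuous : forall i f,
    pc_affine i f -> {within pc_cell i, continuous f};
  affine_finite_dim : forall i, exists k (phi : pc_space -> 'rV[R]_k),
    affine_chart (pc_cell i) (pc_affine i) phi;
  cell_polytope : forall i k (phi : pc_space -> 'rV[R]_k),
    affine_chart (pc_cell i) (pc_affine i) phi ->
    exists P : set 'rV[R]_k,
      [/\ convex_polytope P, ~ in_hyperplane P &
          homeomorphism_between (pc_cell i) P phi];
  face_cell : forall i k (phi : pc_space -> 'rV[R]_k),
    affine_chart (pc_cell i) (pc_affine i) phi ->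
    forall F, face_of affine_functions F (phi @` pc_cell i) ->
    exists j, pc_cell j = pc_cell i `&` phi @^-1` F;
  (* [face_of (pc_affine i)] describes the same subsets of [pc_cell i] as the
     preimages in [face_cell], since [pc_affine i] consists of the affine
     functions of the coordinates. *)
  affine_face : forall i j, face_of (pc_affine i) (pc_cell j) (pc_cell i) ->
    pc_affine j = restrict_to (pc_cell j) (pc_affine i);
  relative_interiors_partition : forall x,
    exists! i, relative_interior (pc_cell i) (pc_affine i) x
}.

Record integral_complex (R : realType) := IntegralComplex {
  underlying_complex :> polyhedral_complex R;
  pc_integral : pc_idx underlying_complex ->
    set (pc_space underlying_complex -> R);
  integral_lattice : forall i,
    full_lattice (pc_cell i) (pc_affine i) (pc_integral i);
  integral_constant : forall i, exists2 c : R, c != 0 & pc_integral i (cst c);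
  integral_face : forall i j, face_of (pc_affine i) (pc_cell j) (pc_cell i) ->
    pc_integral j = restrict_to (pc_cell j) (pc_integral i);
  integral_vertex : forall i x, face_of (pc_affine i) [set x] (pc_cell i) ->
    forall f, pc_integral i f -> rational (f x)
}.

Section Subdivisions.
Context {R : realType} (D : integral_complex R).
Implicit Types (J : set (pc_idx D)) (S : set (set (pc_space D))).
Implicit Types (t : set (pc_space D)) (f : pc_space D -> R).

(** A subcomplex of [D] is given by the set [J] of indices of its cells;
    [D] itself is the case [J = setT]. *)
Definition subcomplex J : Prop :=
  forall i j, J i -> face_of (pc_affine i) (pc_cell j) (pc_cell i) -> J j.

Definition polyhedron J : set (pc_space D) := \bigcup_(i in J) pc_cell i.

(** [Sk^0] of a family of cells: the points which are 0-dimensional cells. *)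
Definition Sk0 S : set (pc_space D) := [set x | S [set x]].

Definition pc_cells J : set (set (pc_space D)) := [set pc_cell i | i in J].

Definition rational_point (i : pc_idx D) (x : pc_space D) : Prop :=
  pc_cell i x /\ forall f, pc_integral i f -> rational (f x).

Definition polytope_in (i : pc_idx D) t : Prop :=
  exists n (p : 'I_n.+1 -> pc_space D),
    (forall j, pc_cell i (p j)) /\ t = hull_in (pc_cell i) (pc_affine i) p.

Definition rational_polytope_in (i : pc_idx D) t : Prop :=
  exists n (p : 'I_n.+1 -> pc_space D),
    (forall j, rational_point i (p j)) /\
    t = hull_in (pc_cell i) (pc_affine i) p.

Definition simplex_in (i : pc_idx D) t : Prop :=
  exists n (p : 'I_n.+1 -> pc_space D),
    [/\ forall j, pc_cell i (p j), affinely_independent (pc_affine i) p &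
        t = hull_in (pc_cell i) (pc_affine i) p].

Definition subdivision J S : Prop :=
  [/\ finite_set S,
      forall t, S t -> exists2 i, J i & rational_polytope_in i t,
      forall i t t', J i -> S t -> t `<=` pc_cell i ->
        face_of (pc_affine i) t' t -> S t',
      forall i t t', J i -> S t -> S t' ->
        t `<=` pc_cell i -> t' `<=` pc_cell i ->
        t `&` t' !=set0 ->
        face_of (pc_affine i) (t `&` t') t /\
        face_of (pc_affine i) (t `&` t') t' &
      \bigcup_(t in S) t = polyhedron J].

Definition triangulation J S : Prop :=
  subdivision J S /\ forall t, S t -> exists2 i, J i & simplex_in i t.

Definition subdivision_restriction S J : set (set (pc_space D)) :=
  [set t | S t /\ exists2 i, J i & t `<=` pc_cell i].

Definition linear_on_subset (i : pc_idx D) t f : Prop :=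
  exists2 g, pc_affine i g & forall x, t x -> f x = g x.

Definition piecewise_linear_on_cell (i : pc_idx D) f : Prop :=
  exists n (t : 'I_n -> set (pc_space D)),
    [/\ forall j, polytope_in i (t j), \bigcup_j t j = pc_cell i &
        forall j, linear_on_subset i (t j) f].

Definition convex_down_on_cell (i : pc_idx D) f : Prop :=
  forall (x y z : pc_space D) (lambda mu : R),
    pc_cell i x -> pc_cell i y -> pc_cell i z ->
    0 <= lambda -> 0 <= mu -> lambda + mu = 1 ->
    (forall g, pc_affine i g -> g z = lambda * g x + mu * g y) ->
    lambda * f x + mu * f y <= f z.

(** Only the restriction of [f] to [polyhedron J] matters. *)
Definition lifting_function J f : Prop :=
  [/\ {within polyhedron J, continuous f},
      forall i, J i -> piecewise_linear_on_cell i f,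
      forall i, J i -> convex_down_on_cell i f &
      forall i x, J i -> rational_point i x -> rational (f x)].

Definition linear_on_cells J S f : Prop :=
  forall t, S t ->
    exists i, [/\ J i, t `<=` pc_cell i & linear_on_subset i t f].

Definition subdivision_refines S' S : Prop :=
  forall t', S' t' -> exists2 t, S t & t' `<=` t.

Definition induced_by J S f : Prop :=
  [/\ subdivision J S, linear_on_cells J S f &
      forall S', subdivision J S' -> linear_on_cells J S' f ->
        subdivision_refines S' S].

End Subdivisions.

(* Main.v *)
Require Import Defs.
From mathcomp Require Import all_boot all_order all_algebra.
From mathcomp Require Import all_classical all_reals all_analysis.
From mathcomp Require Import ring lra.
Import Order.TTheory GRing.Theory Num.Theory.
Import numFieldNormedType.Exports.

Set Implicit Arguments.
Unset Strict Implicit.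
Unset Printing Implicit Defensive.

Local Open Scope classical_set_scope.
Local Open Scope ring_scope.

(** Mark the points [A] that are vertices of the complex or of the given
    triangulation [S0], and give every [a] in [A] a height [h a]. On each cell
    take the least concave function that is at least [h] on the marked points:
    its value at [x] is the largest [\sum_j w j * h j] over all ways of writing
    [x] as a convex combination, with weights [w], of marked points of the
    cell. Such a combination only uses points of the face that carries [x], so
    these functions agree on common faces and define one function
    [hull_height] on the complex. By linear programming duality
    ([height_duality], from the Farkas lemma) its value at [x] is also the least
    value at [x] of an affine function lying above all heights of the cell.
    Hence the domains of linearity are the contact sets of [hull_height] with
    its affine majorants, each contact set is the hull of the marked points at
    which the majorant is tight, and the contact sets form the subdivision
    induced by [hull_height] ([hull_subdivision], [hull_induced]), whatever the
    heights are.

    If the heights on the subcomplex are the values of [f0], then on the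
    subcomplex [hull_height] is [f0] itself: concavity of [f0] gives one
    inequality and linearity of [f0] on the simplices of [S0] the other. So the
    contact sets there are the simplices of [S0]. They need not be simplices
    elsewhere, and the heights have to be perturbed, on the subcomplex too
    (a square may have two opposite edges in the subcomplex, with [f0 = 0]).
    The perturbation keeps [S0]: at a simplex the tight points are affinely
    independent, so the majorant can be corrected to follow any small change of
    heights ([tight_stable]), and a subdivision that contains all of [S0] equals
    [S0] ([subdivision_sub_eq]). An affinely dependent tight set would impose a
    nontrivial linear condition on the heights; there are finitely many
    possible conditions, and suitable arbitrarily small rational perturbations
    violate all of them ([perturbed_generic]). Then all contact sets are
    simplices with vertices in [A], and barycentric coordinates of rational
    points are rational, so that [hull_height] respects the integral
    structure. *)

(** * The Farkas lemma *)

Section Farkas.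
Context {R : realType} {W : lmodType R} (V : set W).

Definition linear_on (a : W -> R) : Prop :=
  forall c x y, V x -> V y -> a (c *: x + y) = c * a x + a y.

Hypothesis V0 : V 0.
Hypothesis VD : forall c x y, V x -> V y -> V (c *: x + y).

Lemma linear_on0 a : linear_on a -> a 0 = 0.
Proof.
move=> la; have := la 1 0 0 V0 V0; rewrite scaler0 addr0 mul1r => h.
by apply: (addrI (a 0)); rewrite addr0.
Qed.

(** Induction on the number of functionals. If [a i0] is indispensable, some
    [z] has [a i z >= 0] for the remaining [i] but [g z < 0]; then [a i0 z < 0].
    Composing all functionals with the projection along [z] onto the kernel of
    [a i0] removes [a i0], and its coefficient is recovered by evaluating
    at [z]. *)
Lemma farkas_seq (I : eqType) (s : seq I) : uniq s ->
  forall (a : I -> W -> R) (g : W -> R),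
  (forall i, linear_on (a i)) -> linear_on g ->
  (forall x, V x -> (forall i, i \in s -> 0 <= a i x) -> 0 <= g x) ->
  exists u : I -> R, (forall i, 0 <= u i) /\
    forall x, V x -> g x = \sum_(i <- s) u i * a i x.
Proof.
elim: s => [_ a g la lg hg|i0 s IH /= /andP[i0s us] a g la lg hg].
  exists (fun=> 0); split=> // x Vx; rewrite big_nil.
  have g0 : 0 <= g x by apply: hg.
  have Vn : V (- x) by have := VD (-1) Vx V0; rewrite addr0 scaleN1r.
  have : 0 <= g (- x) by apply: hg.
  have := lg (-1) x 0 Vx V0; rewrite addr0 scaleN1r (linear_on0 lg) => ->.
  by move=> gn; apply/eqP; rewrite eq_le g0; lra.
have [h|] := pselect (forall x, V x -> (forall i, i \in s -> 0 <= a i x) ->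
    0 <= g x).
  have [u [u0 hu]] := IH us a g la lg h.
  exists (fun i => if i == i0 then 0 else u i); split=> [i|x Vx].
    by case: ifP.
  rewrite big_cons eqxx mul0r add0r (hu _ Vx).
  by apply: eq_big_seq => i si; case: eqP si i0s => // -> ->.
move=> /existsNP[z] /not_implyP[Vz] /not_implyP[az] /negP; rewrite -ltNge => gz.
set b := a i0.
have bz : b z < 0.
  rewrite ltNge; apply/negP => bz.
  suff : 0 <= g z by rewrite leNgt gz.
  by apply: hg => // i; rewrite in_cons => /orP[/eqP->|/az].
(* Functionals composed with the projection along [z] onto the kernel of [b]. *)
pose a' i x := a i x - (b x / b z) * a i z.
pose g' x := g x - (b x / b z) * g z.
have lin' f : linear_on f -> linear_on (fun x => f x - (b x / b z) * f z).
  by move=> lf c x y Vx Vy; rewrite lf // /b la //; ring.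
have [|u [u0 hu]] := IH us a' g' (fun i => lin' _ (la i)) (lin' _ lg).
  move=> x Vx ax.
  pose y := (- (b x / b z)) *: z + x.
  have Vy : V y by exact: VD.
  have fy f : linear_on f -> f y = f x - (b x / b z) * f z.
    by move=> lf; rewrite /y lf //; ring.
  rewrite /g' -(fy _ lg); apply: hg => // i.
  rewrite in_cons => /orP[/eqP->|si]; last by rewrite fy //; exact: ax.
  by rewrite -/b (fy b (la _)); rewrite divfK ?subrr ?lt_eqF.
pose c := (g z - \sum_(i <- s) u i * a i z) / b z.
have c0 : 0 <= c.
  rewrite /c -mulrNN -invrN; apply: mulr_ge0; last by rewrite invr_ge0 oppr_ge0 ltW.
  rewrite opprB subr_ge0 (le_trans (ltW gz)) //.
  by rewrite big_seq; apply: sumr_ge0 => i si; rewrite mulr_ge0 ?az.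
exists (fun i => if i == i0 then c else u i); split=> [i|x Vx].
  by case: ifP.
rewrite big_cons eqxx.
have -> : \sum_(j <- s) (if j == i0 then c else u j) * a j x
        = \sum_(j <- s) u j * a j x.
  apply: eq_big_seq => i si.
  by case: eqP si i0s => // -> ->.
have := hu _ Vx; rewrite /g' /a'.
under eq_bigr do rewrite mulrBr mulrCA.
rewrite sumrB -mulr_sumr => /eqP; rewrite subr_eq => /eqP ->.
by rewrite /c -/b; ring.
Qed.

Lemma farkas (I : finType) (P : pred I) (a : I -> W -> R) (g : W -> R) :
  (forall i, linear_on (a i)) -> linear_on g ->
  (exists u : I -> R, [/\ forall i, 0 <= u i, forall i, ~~ P i -> u i = 0 &
     forall x, V x -> g x = \sum_i u i * a i x]) \/
  (exists x, [/\ V x, forall i, P i -> 0 <= a i x & g x < 0]).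
Proof.
move=> la lg.
have [h|] := pselect (forall x, V x -> (forall i, i \in enum P -> 0 <= a i x) ->
    0 <= g x); [left|move=> nh; right].
  have [u [u0 hu]] := farkas_seq (enum_uniq P) la lg h.
  exists (fun i => if P i then u i else 0); split=> [i|i /negbTE->//|x Vx].
    by case: ifP.
  rewrite (hu x Vx) big_enum /= [RHS](bigID P) /= [X in _ + X]big1 ?addr0.
    by apply: eq_bigr => i Pi; rewrite ifT.
  by move=> i /negbTE ->; rewrite mul0r.
move: nh => /existsNP[x] /not_implyP[Vx] /not_implyP[ax] /negP.
rewrite -ltNge => gx; exists x; split=> // i Pi; apply: ax.
by rewrite mem_enum.
Qed.

End Farkas.

(** * Small perturbations *)

Section Eventually.

Lemma eventually_all (I : finType) (Q : I -> nat -> Prop) :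
  (forall i, exists n0, forall n, (n0 <= n)%N -> Q i n) ->
  exists n0, forall n, (n0 <= n)%N -> forall i, Q i n.
Proof.
move=> /choice[m hm]; exists (\max_i m i)%N => n hn i.
by apply: hm; apply: leq_trans hn; exact: leq_bigmax.
Qed.

Context {R : realType}.

(** Perturbing [u] by a multiple of [k]: a strict inequality survives every
    small perturbation, so only the points where [u] vanishes matter. *)
Lemma dominated_perturbation (I : finType) (P : I -> Prop) (u k : I -> R) :
  (forall i, P i -> 0 <= u i) -> (forall i, P i -> u i = 0 -> 0 <= k i) ->
  exists2 M : R, 0 < M & forall i, P i ->
    0 <= M * u i + k i /\ (M * u i + k i = 0 -> u i = 0 /\ k i = 0).
Proof.
move=> u0 k0.
have [i|n0 hn] := @eventually_all I (fun i n => P i ->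
    0 <= n.+1%:R * u i + k i /\ (n.+1%:R * u i + k i = 0 -> u i = 0 /\ k i = 0)).
  have [Pi|nPi] := pselect (P i); last by exists 0%N.
  have := u0 _ Pi; rewrite le_eqVlt => /predU1P[ui|ui].
    by exists 0%N => n _ _; rewrite -ui mulr0 add0r; split=> //; exact: k0.
  exists (Num.bound (`|k i| / u i)) => n hn _.
  suff : 0 < n.+1%:R * u i + k i.
    by move=> h; split; [exact: ltW | move=> e; rewrite e ltxx in h].
  have h : `|k i| < n.+1%:R * u i.
    rewrite -ltr_pdivrMr //; apply: lt_le_trans (archi_boundP _) _.
      by rewrite divr_ge0 // ltW.
    by rewrite ler_nat ltnW.
  have := ler_norm (- k i); rewrite normrN; lra.
by exists n0.+1%:R; [rewrite ltr0n | exact: hn].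
Qed.

(** The product of the polynomials has finitely many roots. *)
Lemma common_nonroot (I : finType) (p : I -> {poly R}) (n0 : nat) :
  (forall i, p i != 0) ->
  exists2 n, (n0 <= n)%N & forall i, (p i).[n.+1%:R^-1] != 0.
Proof.
move=> p0; pose q := \prod_i p i.
have q0 : q != 0 by apply/prodf_neq0.
pose rs := [seq ((n0 + k)%N.+1%:R)^-1 : R | k <- iota 0 (size q)].
have urs : uniq rs.
  rewrite map_inj_uniq ?iota_uniq // => k1 k2 /invr_inj /eqP.
  by rewrite eqr_nat eqSS eqn_add2l => /eqP.
have : ~~ all (root q) rs.
  apply/negP => h; have := max_poly_roots q0 h urs.
  by rewrite size_map size_iota ltnn.
move=> /allPn[x /mapP[k _ ->]] nr; exists (n0 + k)%N; first exact: leq_addr.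
move=> i; apply: contra nr => /eqP h.
by rewrite /root /q (bigD1 i) //= hornerM h mul0r.
Qed.

End Eventually.

(** * Spaces of affine functions *)

Lemma sum_delta (R : realType) n (j : 'I_n) (F : 'I_n -> R) :
  \sum_l (l == j)%:R * F l = F j.
Proof.
rewrite (bigD1 j) //= eqxx mul1r big1 ?addr0 //.
by move=> l /negbTE ->; rewrite mul0r.
Qed.

Lemma weights_delta (R : realType) n (j : 'I_n) :
  weights (fun l => (l == j)%:R : R).
Proof.
split=> [l|]; first exact: ler0n.
by have := sum_delta j (fun=> 1 : R); under eq_bigr do rewrite mulr1.
Qed.

Section FunctionSpaceTheory.
Context {R : realType} {T : Type} (C : set T) (V : set (T -> R)).
Hypothesis hV : fun_space_on C V.

Lemma fs_eq f g : V f -> (forall x, C x -> f x = g x) -> V g.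
Proof. by case: hV => h _ _; exact: h. Qed.

Lemma fs_cst c : V (cst c).
Proof. by case: hV => _ h _; exact: h. Qed.

Lemma fs_comb a f g : V f -> V g -> V (fun x => a * f x + g x).
Proof. by case: hV => _ _ h; exact: h. Qed.

Lemma fs_add f g : V f -> V g -> V (fun x => f x + g x).
Proof.
move=> Vf Vg; apply: fs_eq (fs_comb 1 Vf Vg) _ => x _ /=.
by rewrite mul1r.
Qed.

Lemma fs_scale a f : V f -> V (fun x => a * f x).
Proof.
move=> Vf; apply: fs_eq (fs_comb a Vf (fs_cst 0)) _ => x _ /=.
by rewrite addr0.
Qed.

Lemma fs_sub f g : V f -> V g -> V (fun x => f x - g x).
Proof.
move=> Vf Vg; apply: fs_eq (fs_comb (-1) Vg Vf) _ => x _ /=.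
by rewrite mulN1r addrC.
Qed.

Lemma fs_sum n (u : 'I_n -> R) (f : 'I_n -> T -> R) :
  (forall j, V (f j)) -> V (fun x => \sum_j u j * f j x).
Proof.
elim: n u f => [|n IH] u f Vf.
  by apply: fs_eq (fs_cst 0) _ => x _ /=; rewrite big_ord0.
apply: fs_eq (fs_add (fs_scale (u ord0) (Vf ord0))
  (IH (fun j => u (lift ord0 j)) (fun j => f (lift ord0 j)) _)) _ => //.
by move=> x _ /=; rewrite big_ord_recl.
Qed.

Lemma eval_linear x : linear_on V (fun f : T -> R => f x).
Proof. by []. Qed.

(** Inside [V], evaluation at [x] is a nonnegative combination of the
    evaluations at the points [p j] as soon as no function of [V] separates
    [x] from them; the constants of [V] make the coefficients sum to [1]. *)
Lemma combination_or_separation n (P : pred 'I_n) (p : 'I_n -> T) (x : T) :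
  (exists w : 'I_n -> R, [/\ weights w, forall j, ~~ P j -> w j = 0 &
     combination V p w x]) \/
  (exists f, [/\ V f, forall j, P j -> 0 <= f (p j) & f x < 0]).
Proof.
have [||[w [w0 wP hw]]|] := @farkas R (T -> R) V (fs_cst 0)
  (fun c f g => @fs_comb c f g) _ P (fun j f => f (p j)) (fun f => f x).
- by move=> j; exact: eval_linear.
- exact: eval_linear.
- left; exists w; split=> //; split=> //.
  by have := hw _ (fs_cst 1) => /= ->; apply: eq_bigr => j _; rewrite mulr1.
- by right.
Qed.

Definition independent_on n (B : {set 'I_n}) (p : 'I_n -> T) : Prop :=
  forall c : 'I_n -> R, (forall j, j \notin B -> c j = 0) ->
    (forall f, V f -> \sum_j c j * f (p j) = 0) -> forall j, c j = 0.

(** Otherwise evaluation at [p b] would be a combination of the evaluations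
    at the other points, taken with both signs in the Farkas lemma. *)
Lemma dual_function n (B : {set 'I_n}) (p : 'I_n -> T) b :
  independent_on B p -> b \in B ->
  exists2 f, V f & forall j, j \in B -> f (p j) = (j == b)%:R.
Proof.
move=> ind bB.
pose a (s : bool * 'I_n) (f : T -> R) := (-1) ^+ s.1 * f (p s.2).
have [||[u [u0 uP hu]]|[f [Vf fP fb]]] := @farkas R (T -> R) V (fs_cst 0)
  (fun c f g => @fs_comb c f g) _ (fun s => s.2 \in B :\ b) a
  (fun f => f (p b)).
- by move=> s c f g _ _; rewrite /a /=; rewrite mulrDr mulrCA.
- exact: eval_linear.
- exfalso.
  pose c j := (j == b)%:R - \sum_(s : bool) u (s, j) * (-1) ^+ s.
  have cb : c b = 1.
    rewrite /c eqxx big1 ?subr0 // => s _.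
    by rewrite uP ?mul0r //= !inE eqxx.
  suff : c b = 0 by rewrite cb => /eqP; rewrite oner_eq0.
  apply: ind => [j jB|f Vf].
    rewrite /c big1 => [|s _].
      by case: eqP jB => [->|_ _]; rewrite ?bB ?subr0.
    by rewrite uP ?mul0r //= !inE (negbTE jB) andbF.
  rewrite /c; under eq_bigr do rewrite mulrBl.
  rewrite sumrB (bigD1 b) //= eqxx mul1r big1 ?addr0; last first.
    by move=> j /negbTE ->; rewrite mul0r.
  apply/eqP; rewrite (hu _ Vf) subr_eq0; apply/eqP.
  under [RHS]eq_bigr do rewrite mulr_suml.
  rewrite exchange_big pair_big /=.
  by apply: eq_bigr => -[s j] _; rewrite /a /= mulrA.
- have eqf j : j \in B -> j != b -> f (p j) = 0.
    move=> jB jb; have := fP (true, j); have := fP (false, j).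
    rewrite /a /= !inE jb jB expr0 expr1 mul1r mulN1r => /(_ isT) h /(_ isT).
    by rewrite oppr_ge0 => h'; apply/eqP; rewrite eq_le h h'.
  exists (fun x => (f (p b))^-1 * f x); first exact: fs_scale.
  move=> j jB; have [->|jb] := eqVneq j b.
    by rewrite mulVf // lt_eqF.
  by rewrite (eqf j) // mulr0.
Qed.

End FunctionSpaceTheory.

(** * Cells as polytopes *)

Section CellGeometry.
Context {R : realType} (D : polyhedral_complex R).
Implicit Types (i m : pc_idx D) (x y z : pc_space D).
Local Notation T := (pc_space D).
Local Notation C := (@pc_cell R D).
Local Notation V := (@pc_affine R D).

Lemma chart_affineP i k (phi : T -> 'rV[R]_k) f :
  affine_chart (C i) (V i) phi -> V i f ->
  exists (a : 'rV[R]_k) b, forall x, C i x ->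
    f x = b + \sum_j a ord0 j * phi x ord0 j.
Proof.
case=> _ span _ /span[u hu].
exists (\row_j u (lift ord0 j)), (u ord0) => x Cx.
rewrite (hu x Cx) big_ord_recl unlift_none /= mulr1; congr (_ + _).
by apply: eq_bigr => j _; rewrite liftK mxE.
Qed.

Lemma affine_in_chart i k (phi : T -> 'rV[R]_k) (a : 'rV[R]_k) b :
  affine_chart (C i) (V i) phi ->
  V i (fun x => b + \sum_j a ord0 j * phi x ord0 j).
Proof.
move=> [inV _ _]; have hV := affine_space i.
have Vphi (j : 'I_k) : V i (fun x => phi x ord0 j).
  by have := inV (lift ord0 j); rewrite liftK.
exact: (fs_add hV (fs_cst hV b) (fs_sum hV (a ord0) Vphi)).
Qed.

Lemma chart_affine_eq0 i k (phi : T -> 'rV[R]_k) (a : 'rV[R]_k) b :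
  affine_chart (C i) (V i) phi ->
  (forall x, C i x -> b + \sum_j a ord0 j * phi x ord0 j = 0) -> a = 0.
Proof.
move=> [_ _ ind] h.
have {}ind := ind (fun j => if unlift ord0 j is Some j' then a ord0 j' else b).
apply/rowP => j; rewrite mxE.
have := ind _ (lift ord0 j); rewrite liftK; apply => x Cx.
rewrite -[RHS](h x Cx) big_ord_recl unlift_none /= mulr1; congr (_ + _).
by apply: eq_bigr => j' _; rewrite liftK.
Qed.

Lemma polytope_chart i : exists k (phi : T -> 'rV[R]_k) n (q : 'I_n.+1 -> 'rV[R]_k),
  [/\ affine_chart (C i) (V i) phi, set_inj (C i) phi &
      phi @` C i = [set y | exists2 w, weights w & y = \sum_j w j *: q j]].
Proof.
have [k [phi ch]] := affine_finite_dim i.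
have [P [[n [q PE]] _ [[fun_ inj_ surj_] _ _]]] := cell_polytope ch.
exists k, phi, n, q; split=> //.
rewrite -PE; apply/seteqP; split=> [y [x Cx <-]|y /surj_ //].
exact: fun_.
Qed.

Lemma cell_separated i x y : C i x -> C i y ->
  (forall f, V i f -> f x = f y) -> x = y.
Proof.
move=> Cx Cy h; have [k [phi [n [q [ch inj_ _]]]]] := polytope_chart i.
apply: inj_; rewrite ?inE //; apply/rowP => j.
have := h _ (affine_in_chart (delta_mx ord0 j) 0 ch).
rewrite !add0r (bigD1 j) //= [in RHS](bigD1 j) //= !mxE !eqxx !mul1r.
rewrite !big1 ?addr0 // => j' /negbTE jj'; by rewrite !mxE jj' andbF mul0r.
Qed.

Lemma chart_combination i k (phi : T -> 'rV[R]_k) n (p : 'I_n -> T) w x :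
  affine_chart (C i) (V i) phi -> C i x -> weights w ->
  (forall j, w j != 0 -> C i (p j)) ->
  phi x = \sum_j w j *: phi (p j) -> combination (V i) p w x.
Proof.
move=> ch Cx [_ w1] Cp phix f Vf.
have [a [b hf]] := chart_affineP ch Vf.
have -> : \sum_j w j * f (p j) =
    \sum_j w j * (b + \sum_l a ord0 l * phi (p j) ord0 l).
  apply: eq_bigr => j _; have [->|wj] := eqVneq (w j) 0; first by rewrite !mul0r.
  by rewrite hf //; exact: Cp.
under eq_bigr do rewrite mulrDr.
rewrite big_split /= -mulr_suml w1 mul1r hf //; congr (_ + _).
under [RHS]eq_bigr do rewrite mulr_sumr.
rewrite exchange_big /=; apply: eq_bigr => l _.
rewrite phix summxE mulr_sumr; apply: eq_bigr => j _.
by rewrite mxE mulrCA.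
Qed.

Lemma cell_hull i : exists n (p : 'I_n.+1 -> T), (forall j, C i (p j)) /\
  forall x, C i x -> exists2 w, weights w & combination (V i) p w x.
Proof.
have [k [phi [n [q [ch inj_ PE]]]]] := polytope_chart i.
have /choice[p hp] : forall j, exists x, C i x /\ phi x = q j.
  move=> j; have : (phi @` C i) (q j).
    rewrite PE /=; exists (fun l => (l == j)%:R).
      exact: weights_delta.
    rewrite (bigD1 j) //= eqxx scale1r big1 ?addr0 // => l /negbTE ->.
    by rewrite scale0r.
  by case=> x Cx <-; exists x.
exists n, p; split=> [j|x Cx]; first by case: (hp j).
have [w hw phix] : [set y | exists2 w, weights w & y = \sum_j w j *: q j] (phi x).
  by rewrite -PE; exists x.
exists w => //; apply: (chart_combination ch) => //.
  by move=> j _; case: (hp j).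
by rewrite phix; apply: eq_bigr => j _; case: (hp j) => _ ->.
Qed.

Lemma cell_convex i n (p : 'I_n -> T) w : weights w ->
  (forall j, w j != 0 -> C i (p j)) ->
  exists2 z, C i z & combination (V i) p w z.
Proof.
move=> hw Cp; have [k [phi [N [q [ch inj_ PE]]]]] := polytope_chart i.
have /choice[W hW] : forall j, exists W : 'I_N.+1 -> R, w j != 0 ->
    weights W /\ phi (p j) = \sum_l W l *: q l.
  move=> j; have [wj|wj] := eqVneq (w j) 0; first by exists (fun=> 0).
  have [W hW e] : [set y | exists2 w, weights w & y = \sum_j w j *: q j]
      (phi (p j)).
    by rewrite -PE; exists (p j) => //; exact: Cp.
  by exists W.
have : (phi @` C i) (\sum_j w j *: phi (p j)).
  rewrite PE /=; exists (fun l => \sum_j w j * W j l).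
    case: hw => w0 w1; split=> [l|].
      apply: sumr_ge0 => j _; have [->|wj] := eqVneq (w j) 0.
        by rewrite mul0r.
      by rewrite mulr_ge0 //; have [[]] := hW j wj.
    rewrite exchange_big /= -w1; apply: eq_bigr => j _; rewrite -mulr_sumr.
    have [->|wj] := eqVneq (w j) 0; first by rewrite mul0r.
    by have [[_ ->] _] := hW j wj; rewrite mulr1.
  under [RHS]eq_bigr do rewrite scaler_suml.
  rewrite exchange_big /=; apply: eq_bigr => j _.
  have [->|wj] := eqVneq (w j) 0.
    by rewrite scale0r big1 // => l _; rewrite mul0r scale0r.
  have [_ ->] := hW j wj; rewrite scaler_sumr.
  by apply: eq_bigr => l _; rewrite scalerA.
case=> z Cz phiz; exists z => //.
exact: (chart_combination ch).
Qed.

Lemma cell_nonempty i : exists x, C i x.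
Proof. by have [n [p [Cp _]]] := cell_hull i; exists (p ord0). Qed.

(** The faces of the chart image are cells; pulling an affine function back
    through the chart identifies them with the zero sets in [C i] of the
    nonnegative functions of [V i]. *)
Lemma zero_set_cell i l x : V i l -> (forall y, C i y -> 0 <= l y) ->
  C i x -> l x = 0 -> exists j, C j = C i `&` [set y | l y = 0].
Proof.
move=> Vl l0 Cx lx; have [k [phi ch]] := affine_finite_dim i.
have [a [b hl]] := chart_affineP ch Vl.
pose l' (y : 'rV[R]_k) := b + \sum_j a ord0 j * y ord0 j.
have [|j Ej] := face_cell ch (F := phi @` C i `&` [set y | l' y = 0]).
- split; first by exists (phi x); split; [exists x|rewrite /= /l' -hl].
  exists l'; first by exists a, b.
  by split=> // _ [y Cy <-]; rewrite /l' -hl //; exact: l0.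
- exists j; rewrite Ej; apply/seteqP; split=> y [Cy].
    by case=> _; rewrite /= /l' -hl.
  by move=> /= ly; split=> //; split; [exists y|rewrite /= /l' -hl].
Qed.

Lemma face_sub i m : face_of (V i) (C m) (C i) -> C m `<=` C i.
Proof. by move=> [_ [l _ [_ ->]]] x []. Qed.

Lemma face_restrict i m f : face_of (V i) (C m) (C i) -> V i f -> V m f.
Proof. by move=> h Vf; rewrite (affine_face h); exists f. Qed.

Lemma face_extend i m f : face_of (V i) (C m) (C i) -> V m f ->
  exists2 g, V i g & forall x, C m x -> f x = g x.
Proof. by move=> h; rewrite (affine_face h) => -[g Vg e]; exists g. Qed.

End CellGeometry.

(** * The carrier of a point *)

Lemma weighted_sum_eq0 (R : realType) n (w u : 'I_n -> R) :
  (forall j, 0 <= w j) -> (forall j, w j != 0 -> 0 <= u j) ->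
  \sum_j w j * u j = 0 -> forall j, w j != 0 -> u j = 0.
Proof.
move=> w0 u0 /eqP; rewrite psumr_eq0 => [/allP h j wj|j _]; last first.
  have [->|wj] := eqVneq (w j) 0; first by rewrite mul0r.
  by rewrite mulr_ge0 ?u0.
have := h j (mem_index_enum j); rewrite mulf_eq0 (negbTE wj) /=.
by move/eqP.
Qed.

Section Carrier.
Context {R : realType} (D : polyhedral_complex R).
Implicit Types (i m : pc_idx D) (x y z : pc_space D).
Local Notation T := (pc_space D).
Local Notation C := (@pc_cell R D).
Local Notation V := (@pc_affine R D).

(** The algebraic form of the relative interior: no supporting hyperplane
    through [x] meets [t] properly. With [W] the affine functions of any cell
    containing [t], it makes sense for every polytope [t] in the cell. *)
Definition inner_point (W : set (T -> R)) (t : set T) x : Prop :=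
  t x /\ forall l, W l -> (forall y, t y -> 0 <= l y) -> l x = 0 ->
    forall y, t y -> l y = 0.

(** If, in the chart, a direction [e_j] or [- e_j] were not a nonnegative
    combination of the vectors from [y] to the generators [q r] of the polytope,
    a separating linear form would define a supporting hyperplane through [x].
    So all these directions are such combinations, and every point of a small
    ball around [y] is a convex combination of [y] and the [q r]. *)
Lemma relative_interior_inner m x :
  inner_point (V m) (C m) x -> relative_interior (C m) (V m) x.
Proof.
move=> [Cx inn]; split=> //.
have [k [phi [n [q [ch _ PE]]]]] := polytope_chart m.
exists k, phi; split=> //; set y := phi x.
have [w [w0 w1] yE] : [set y | exists2 w, weights w & y = \sum_j w j *: q j] y.
  by rewrite -PE; exists x.
have /choice[u hu] : forall js : 'I_k * bool, exists u : 'I_n.+1 -> R,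
    (forall r, 0 <= u r) /\ forall l, \sum_r u r * (q r ord0 l - y ord0 l) =
      (-1) ^+ js.2 * (l == js.1)%:R.
  move=> [j s].
  have [|||[u [u0 _ hu]]|[a [_ ap aj]]] := @farkas R 'rV[R]_k setT I _ _ xpredT
    (fun r (a : 'rV[R]_k) => \sum_l a ord0 l * (q r ord0 l - y ord0 l))
    (fun a => (-1) ^+ s * a ord0 j).
  - by [].
  - move=> r c a b _ _; rewrite mulr_sumr -big_split /=.
    by apply: eq_bigr => l _; rewrite !mxE; ring.
  - by move=> c a b _ _; rewrite !mxE; ring.
  - exists u; split=> // l; have := hu (delta_mx ord0 l) I.
    rewrite !mxE eqxx /= eq_sym => ->; apply: eq_bigr => r _; congr (_ * _).
    rewrite (bigD1 l) //= big1 ?addr0 => [|l' /negbTE ll'].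
      by rewrite !mxE !eqxx mul1r.
    by rewrite !mxE ll' andbF mul0r.
  - exfalso; suff a0 : a = 0 by move: aj; rewrite a0 mxE mulr0 ltxx.
    pose b := - \sum_l a ord0 l * y ord0 l.
    apply: (@chart_affine_eq0 _ _ m k phi a b ch) => z Cz.
    apply: (inn _ (affine_in_chart a b ch)) => // [z' Cz'|]; last first.
      by rewrite /b /y addrC subrr.
    have [v [v0 v1] ->] : [set y | exists2 w, weights w &
        y = \sum_j w j *: q j] (phi z').
      by rewrite -PE; exists z'.
    have -> : b + \sum_l a ord0 l * (\sum_r v r *: q r) ord0 l =
      \sum_r v r * \sum_l a ord0 l * (q r ord0 l - y ord0 l).
      under [RHS]eq_bigr do (under eq_bigr do rewrite mulrBr;
        rewrite sumrB mulrBr).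
      rewrite sumrB -mulr_suml v1 mul1r addrC; congr (_ + _).
      under [LHS]eq_bigr do rewrite summxE mulr_sumr.
      under [RHS]eq_bigr do rewrite mulr_sumr.
      rewrite exchange_big /=; apply: eq_bigr => r _; apply: eq_bigr => l _.
      by rewrite mxE mulrCA.
    by apply: sumr_ge0 => r _; rewrite mulr_ge0 ?ap.
pose L := \sum_(js : 'I_k * bool) \sum_r u js r.
have u0 js r : 0 <= u js r by case: (hu js).
have L0 : 0 <= L by apply: sumr_ge0 => js _; apply: sumr_ge0.
have L1 : 0 < L + 1 by rewrite ltr_wpDl.
rewrite /interior /= nbhs_ballP; exists (L + 1)^-1 => /=; first by rewrite invr_gt0.
move=> z [_ yz].
have {yz}yz j : `|z ord0 j - y ord0 j| <= (L + 1)^-1.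
  by rewrite distrC; apply: ltW; exact: (yz ord0 j).
pose d j := z ord0 j - y ord0 j.
(* Coefficients expressing [z - y] through the vectors [q r - y]; [d j < 0]
   selects the sign of the direction. *)
pose mu r := \sum_j `|d j| * u (j, d j < 0) r.
have mu0 r : 0 <= mu r.
  by apply: sumr_ge0 => j _; rewrite mulr_ge0.
have mu1 : \sum_r mu r <= 1.
  rewrite /mu exchange_big /=.
  apply: (@le_trans _ _ ((L + 1)^-1 * L)); last first.
    by rewrite mulrC ler_pdivrMr // mul1r lerDl.
  have -> : (L + 1)^-1 * L =
      \sum_j (L + 1)^-1 * \sum_(s : bool) \sum_r u (j, s) r.
    rewrite -mulr_sumr; congr (_ * _); rewrite pair_bigA /=.
    by apply: eq_bigr => -[].
  apply: ler_sum => j _; rewrite -mulr_sumr.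
  apply: ler_pM => //; [exact: sumr_ge0 | exact: yz |].
  rewrite (bigD1 (d j < 0)) //= lerDl.
  by apply: sumr_ge0 => s _; exact: sumr_ge0.
have : (phi @` C m) z; last by [].
rewrite PE /=; exists (fun r => (1 - \sum_r mu r) * w r + mu r).
  split=> [r|].
    by rewrite addr_ge0 // mulr_ge0 // subr_ge0.
  by rewrite big_split /= -mulr_sumr w1 mulr1 subrK.
apply/rowP => l; rewrite summxE.
under eq_bigr do rewrite mxE mulrDl -mulrA.
rewrite big_split /= -mulr_sumr.
have -> : \sum_r w r * q r ord0 l = y ord0 l.
  by rewrite yE summxE; apply: eq_bigr => r _; rewrite mxE.
have : \sum_r mu r * (q r ord0 l - y ord0 l) = d l.
  rewrite /mu; under eq_bigr do rewrite mulr_suml.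
  rewrite exchange_big /=.
  transitivity (\sum_j `|d j| * ((-1) ^+ (d j < 0)%R * (l == j)%:R)).
    apply: eq_bigr => j _; have [_ <-] := hu (j, d j < 0).
    by rewrite mulr_sumr; apply: eq_bigr => r _; rewrite mulrA.
  rewrite (bigD1 l) //= eqxx mulr1 big1 ?addr0; last first.
    by move=> j jl; rewrite eq_sym (negbTE jl) !mulr0.
  by rewrite mulrC -numEsign.
have -> : \sum_r mu r * (q r ord0 l - y ord0 l) =
    \sum_r mu r * q r ord0 l - (\sum_r mu r) * y ord0 l.
  by rewrite mulr_suml -sumrB; apply: eq_bigr => r _; rewrite mulrBr.
rewrite /d => e.
by rewrite -(subrK (y ord0 l) (z ord0 l)) -e; ring.
Qed.

(** Among the functions of [V i] that are nonnegative on the cell and vanish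
    at [x], a sum of finitely many has the smallest zero set; this zero set is
    the face of [C i] that has [x] in its relative interior. *)
Lemma minimal_face i x : C i x -> exists m,
  [/\ face_of (V i) (C m) (C i), C m x & inner_point (V m) (C m) x].
Proof.
move=> Cx; have hV := affine_space i; have [n [p [Cp hull]]] := cell_hull i.
pose good l := [/\ V i l, forall y, C i y -> 0 <= l y & l x = 0].
have /choice[l hl] : forall r, exists l, good l /\
    (l (p r) = 0 -> forall k, good k -> k (p r) = 0).
  move=> r; have [[l [gl lr]]|h] := pselect (exists l, good l /\ l (p r) <> 0).
    by exists l; split=> // /lr.
  exists (cst 0); split=> [|_ k gk]; first by split=> //; exact: (fs_cst hV).
  by apply: contrapT => kr; apply: h; exists k.
pose s y := \sum_r 1 * l r y.
have gs : good s.
  split; first by apply: (fs_sum hV (fun=> 1)) => r; case: (hl r) => -[].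
    by move=> y Cy; apply: sumr_ge0 => r _; rewrite mul1r; case: (hl r) => -[_ + _] _; exact.
  by rewrite /s big1 // => r _; rewrite mul1r; case: (hl r) => -[].
have sp r : s (p r) = 0 -> forall k, good k -> k (p r) = 0.
  move=> sr; case: (hl r) => _; apply.
  have := @weighted_sum_eq0 _ _ (fun=> 1) (fun r' => l r' (p r)) (fun=> ler01).
  move=> /(_ _ sr r (oner_neq0 _)); apply => r' _.
  by case: (hl r') => -[_ + _] _; exact.
have [Vs s0 sx] := gs.
have [m Em] := zero_set_cell Vs s0 Cx sx.
have fm : face_of (V i) (C m) (C i).
  split; first by exists x; rewrite Em.
  by exists s.
have Cmx : C m x by rewrite Em.
exists m; split=> //; split=> // k Vk k0 kx y Cmy.
have [g Vg kg] := face_extend fm Vk.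
have Cmp r : s (p r) = 0 -> C m (p r) by rewrite Em.
have [||M M0 hM] := @dominated_perturbation R 'I_n.+1 (fun=> True)
  (fun r => s (p r)) (fun r => g (p r)).
- by move=> r _; exact: s0.
- by move=> r _ /Cmp h; rewrite -kg //; exact: k0.
(* [M * s + g] is itself nonnegative on [C i] and vanishes at [x], so its zero
   set contains that of [s]. *)
have gp r : s (p r) = 0 -> g (p r) = 0.
  move=> sr; have [_ h] := hM r I.
  suff /h[] : M * s (p r) + g (p r) = 0 by [].
  have gg : good (fun y => M * s y + g y).
    split; first exact: (fs_comb hV).
      move=> z Cz; have [w [w0 _] cw] := hull z Cz.
      rewrite (cw _ (fs_comb hV M Vs Vg)).
      by apply: sumr_ge0 => r' _; rewrite mulr_ge0 //; case: (hM r' I).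
    by rewrite sx mulr0 add0r -kg.
  exact: (sp r sr _ gg).
have [Ciy sy] : C i y /\ s y = 0 by move: Cmy; rewrite Em.
have [w [w0 _] cw] := hull y Ciy.
rewrite kg // (cw _ Vg) big1 // => r _.
have [->|wr] := eqVneq (w r) 0; first by rewrite mul0r.
rewrite gp ?mulr0 //.
apply: (@weighted_sum_eq0 _ _ w (fun r => s (p r))) => //.
  by move=> r' _; exact: s0.
by rewrite -(cw _ Vs).
Qed.

(** The unique cell with [x] in its relative interior. Any two cells through
    [x] have it as a common face, which is how they are compared below. *)
Definition carrier x : pc_idx D := sval (cid (relative_interiors_partition x)).

Lemma carrier_face i x : C i x -> face_of (V i) (C (carrier x)) (C i).
Proof.
move=> /minimal_face[m [fm _ /relative_interior_inner rm]].
by rewrite /carrier; case: cid => m' [_ /= /(_ _ rm) ->].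
Qed.

Lemma carrier_cell x : C (carrier x) x.
Proof. by rewrite /carrier; case: cid => m [[]]. Qed.

End Carrier.

(** * Inner points and vertices *)

Section Vertices.
Context {R : realType} (D : polyhedral_complex R).
Implicit Types (i m : pc_idx D) (x y z : pc_space D).
Local Notation T := (pc_space D).
Local Notation C := (@pc_cell R D).
Local Notation V := (@pc_affine R D).

(** The function that cuts the carrier out of [C i] vanishes at [x], hence on
    all of [t]. *)
Lemma inner_point_carrier i t x : t `<=` C i -> inner_point (V i) t x ->
  t `<=` C (carrier x).
Proof.
move=> ti [tx inn] y ty.
have [_ [k Vk [k0 Ek]]] := carrier_face (ti _ tx).
rewrite Ek; split; first exact: ti.
apply: (inn k Vk) => //; first by move=> z tz; exact: k0 (ti _ tz).
by have := carrier_cell x; rewrite Ek => -[].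
Qed.

(** Two cells containing [t] induce the same affine functions on [t], because
    both restrict to the carrier of an inner point of [t]. *)
Lemma affine_transfer i m t x f : t `<=` C i -> inner_point (V i) t x ->
  C m x -> V m f -> exists2 g, V i g & forall y, t y -> f y = g y.
Proof.
move=> ti tx mx Vf; have tc := inner_point_carrier ti tx.
have Vcf := face_restrict (carrier_face mx) Vf.
have [g Vg fg] := face_extend (carrier_face (ti _ tx.1)) Vcf.
by exists g => // y /tc; exact: fg.
Qed.

Lemma inner_point_transfer i m t x : t `<=` C i -> inner_point (V i) t x ->
  t `<=` C m -> inner_point (V m) t x.
Proof.
move=> ti tx tm; split; first exact: tx.1.
move=> l Vl l0 lx y ty.
have [g Vg lg] := affine_transfer ti tx (tm _ tx.1) Vl.
rewrite lg //; apply: tx.2 => // [z tz|]; first by rewrite -lg //; exact: l0.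
by rewrite -lg //; exact: tx.1.
Qed.

(** A point that is a cell is its own carrier. *)
Lemma vertex_face m i x : C m = [set x] -> C i x -> face_of (V i) (C m) (C i).
Proof.
move=> Em ix; have mx : C m x by rewrite Em.
have -> : C m = C (carrier x); last exact: carrier_face.
apply/seteqP; split=> [y|]; last exact: face_sub (carrier_face mx).
by rewrite Em => ->; exact: carrier_cell.
Qed.

Lemma affine_min i f : V i f ->
  exists2 x, C i x & forall y, C i y -> f x <= f y.
Proof.
move=> Vf; have [n [p [Cp hull]]] := cell_hull i.
case: (@arg_minP _ _ _ ord0 xpredT (fun r => f (p r)) isT) => r _ rmin.
exists (p r) => // y Cy; have [w [w0 w1] cw] := hull y Cy.
rewrite (cw _ Vf) -[leLHS]mul1r -w1 mulr_suml.
by apply: ler_sum => r' _; rewrite ler_wpM2l ?rmin.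
Qed.

Lemma zero_set_min_cell i f x : V i f -> C i x ->
  (forall y, C i y -> f x <= f y) ->
  exists m, C m = C i `&` [set y | f y = f x].
Proof.
move=> Vf Cx fx; have hV := affine_space i.
have [||m Em] := @zero_set_cell _ _ i (fun y => f y - f x) x
  (fs_sub hV Vf (fs_cst hV (f x))) _ Cx.
- by move=> y Cy; rewrite subr_ge0 fx.
- by rewrite subrr.
exists m; rewrite Em; apply/seteqP; split=> y [Cy /= e]; split=> //=.
  by apply/eqP; rewrite -subr_eq0 e.
by rewrite e subrr.
Qed.

(** A cell with the fewest subcells has no nonconstant affine function, since
    the minimum set of such a function is a smaller cell. *)
Lemma cell_has_vertex i : exists m x, C m = [set x] /\ C i x.
Proof.
pose sub m := [set m' | `[< C m' `<=` C m >]]%SET.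
have ii : `[< C i `<=` C i >] by apply/asboolP.
case: (@arg_minnP _ i (fun m => `[< C m `<=` C i >]) (fun m => #|sub m|) ii).
move=> m /asboolP mi mmin; have [x mx] := cell_nonempty m.
exists m, x; split; last exact: mi.
apply/seteqP; split=> [y my|y ->//] /=.
apply: (cell_separated my mx) => f Vf.
have [z mz zmin] := affine_min Vf; have [m' Em'] := zero_set_min_cell Vf mz zmin.
have m'm : C m' `<=` C m by rewrite Em' => u [].
have : sub m' = sub m.
  apply/eqP; rewrite eqEcard; apply/andP; split.
    by apply/fintype.subsetP => u; rewrite !inE => um v /um /m'm.
  by apply: mmin; apply/asboolP => v /m'm/mi.
move=> /finset.setP/(_ m); rewrite !inE => e.
have h : C m `<=` C m' by apply/asboolP; rewrite e; apply/asboolP.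
by have := h _ my; have := h _ mx; rewrite Em' /= => -[_ ->] [_ ->].
Qed.

(** The minimum of [f] on the cell is attained on a face, which contains a
    vertex. *)
Lemma affine_ge0_on_vertices i f : V i f ->
  (forall m v, C m = [set v] -> C i v -> 0 <= f v) ->
  forall x, C i x -> 0 <= f x.
Proof.
move=> Vf f0 x Cx; have [z iz zmin] := affine_min Vf.
have [m Em] := zero_set_min_cell Vf iz zmin.
have [m' [v [Em' mv]]] := cell_has_vertex m.
move: mv; rewrite Em => -[iv /= fv].
by apply: le_trans (zmin _ Cx); rewrite -fv; exact: f0 Em' iv.
Qed.

End Vertices.

Section RationalPoints.
Context {R : realType} (D : integral_complex R).
Implicit Types (i m : pc_idx D) (x y z : pc_space D).
Local Notation C := (@pc_cell R D).
Local Notation V := (@pc_affine R D).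

(** Both integral structures restrict to that of the carrier. *)
Lemma rational_point_transfer i m x :
  rational_point i x -> C m x -> rational_point m x.
Proof.
move=> [ix rx] mx; split=> // f Lf.
have : pc_integral (carrier x) f.
  by rewrite (integral_face (carrier_face mx)); exists f.
rewrite (integral_face (carrier_face ix)) => -[g Lg ->]; first exact: rx.
exact: carrier_cell.
Qed.

Lemma rational_vertex m i x : C m = [set x] -> C i x -> rational_point i x.
Proof.
move=> Em ix; split=> //; apply: integral_vertex.
by rewrite -Em; exact: vertex_face Em ix.
Qed.

(** The barycenter of the generators is an inner point. *)
Lemma polytope_inner_point i t : polytope_in i t ->
  t `<=` C i /\ exists x, inner_point (V i) t x.
Proof.
move=> [n [p [Cp ->]]]; split; first by move=> x [].
have hw : weights (fun _ : 'I_n.+1 => n.+1%:R^-1 : R).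
  split=> [j|]; first by rewrite invr_ge0.
  by rewrite sumr_const card_ord -[LHS]mulr_natl mulfV // pnatr_eq0.
have [z Cz cz] := @cell_convex _ _ i _ p _ hw (fun j _ => Cp j).
exists z; split; first by split=> //; exists (fun=> n.+1%:R^-1).
move=> l Vl l0 lz y [Cy [w _ cw]].
have lp j : l (p j) = 0.
  apply: (@weighted_sum_eq0 _ _ (fun=> n.+1%:R^-1 : R) (fun j => l (p j))) => //.
  - move=> j' _; apply: l0; split=> //; exists (fun r => (r == j')%:R).
      exact: weights_delta.
    by move=> f _; rewrite sum_delta.
  - by rewrite -(cz _ Vl).
by rewrite (cw _ Vl) big1 // => j _; rewrite lp mulr0.
Qed.

Lemma rational_polytope_in_polytope i t :
  rational_polytope_in i t -> polytope_in i t.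
Proof. by move=> [n [p [rp ->]]]; exists n, p; split=> // j; case: (rp j). Qed.

End RationalPoints.

(** * Duality for heights on marked points *)

Section Heights.
Context {R : realType} (D : polyhedral_complex R) (N : nat).
Context (a : 'I_N -> pc_space D) (h : 'I_N -> R).
Implicit Types (i m : pc_idx D) (x y z : pc_space D) (w : 'I_N -> R).
Local Notation T := (pc_space D).
Local Notation C := (@pc_cell R D).
Local Notation V := (@pc_affine R D).

Hypothesis vertices_marked : forall m x, C m = [set x] -> exists j, a j = x.

Definition marked_combination i x w : Prop :=
  [/\ weights w, forall j, w j != 0 -> C i (a j) & combination (V i) a w x].

Definition majorant i (l : T -> R) : Prop :=
  V i l /\ forall j, C i (a j) -> h j <= l (a j).

Lemma marked_combination_exists i x : C i x ->
  exists w, marked_combination i x w.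
Proof.
move=> Cx; have [[w [hw w0 cw]]|[f [Vf f0 fx]]] := combination_or_separation
  (affine_space i) (fun j => `[< C i (a j) >]) a x.
  exists w; split=> // j wj; apply: contrapT => nC; move: wj.
  by rewrite w0 ?eqxx //; exact/asboolPn.
exfalso; suff : 0 <= f x by rewrite leNgt fx.
apply: (affine_ge0_on_vertices Vf) Cx => m v Em iv.
have [j aj] := vertices_marked Em; rewrite -aj.
by apply: f0; apply/asboolP; rewrite aj.
Qed.

(** A function cutting out the carrier vanishes at [x] and is nonnegative at
    the marked points, so it vanishes at all points of positive weight. *)
Lemma marked_combination_carrier i x w : C i x ->
  marked_combination i x w <-> marked_combination (carrier x) x w.
Proof.
move=> Cx; have fc := carrier_face Cx; split=> -[hw wC cw].
  have [_ [k Vk [k0 Ek]]] := fc.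
  have kx : k x = 0 by have := carrier_cell x; rewrite Ek => -[].
  have wc j : w j != 0 -> C (carrier x) (a j).
    move=> wj; rewrite Ek; split; first exact: wC.
    apply: (@weighted_sum_eq0 _ _ w (fun j => k (a j))) => //.
    - by case: hw.
    - by move=> j' /wC; exact: k0.
    - by rewrite -(cw _ Vk).
  split=> // f Vf; have [g Vg fg] := face_extend fc Vf.
  rewrite fg ?(cw _ Vg); last exact: carrier_cell.
  apply: eq_bigr => j _; have [->|wj] := eqVneq (w j) 0; first by rewrite !mul0r.
  by rewrite fg //; exact: wc.
split=> // [j /wC|f Vf]; first exact: (face_sub fc).
exact: cw (face_restrict fc Vf).
Qed.

Lemma combination_le_majorant i x w l :
  marked_combination i x w -> majorant i l -> \sum_j w j * h j <= l x.
Proof.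
move=> [[w0 _] wC cw] [Vl hl]; rewrite (cw _ Vl); apply: ler_sum => j _.
have [->|wj] := eqVneq (w j) 0; first by rewrite !mul0r.
by rewrite ler_wpM2l // hl //; exact: wC.
Qed.

(** Linear programming duality, with [v] the supremum of the heights of
    combinations at [x]. The Farkas lemma is applied to the functionals
    [(g, c) |-> g (a j) - c * h j] on pairs. It shows first that [v] is
    attained, since a separating pair would bound all combinations away from
    [v], and then that some pair with [c > 0] defines a majorant [g / c] of
    value at most [v] at [x]. *)
Lemma height_duality i x : C i x -> exists v : R,
  (exists2 w, marked_combination i x w & \sum_j w j * h j = v) /\
  (exists2 l, majorant i l & l x = v).
Proof.
move=> Cx; have hV := affine_space i.
have [w1 cw1] := marked_combination_exists Cx.
pose E := [set v | exists2 w, marked_combination i x w & \sum_j w j * h j = v].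
have supE : has_sup E.
  split; first by exists (\sum_j w1 j * h j), w1.
  exists (\sum_j `|h j|) => _ [w [[w0 w1_] _ _] <-].
  apply: ler_sum => j _; apply: le_trans (ler_norm _) _.
  rewrite normrM (ger0_norm (w0 j)) ler_piMl //.
  by rewrite -w1_ (bigD1 j) //= lerDl sumr_ge0.
pose v := sup E; exists v.
have Ev w : marked_combination i x w -> \sum_j w j * h j <= v.
  by move=> cw; apply: sup_upper_bound => //; exists w.
pose W := [set gc : (T -> R) * R | V i gc.1].
have W0 : W 0 by exact: (fs_cst hV 0).
have WD c (s t : (T -> R) * R) : W s -> W t -> W (c *: s + t).
  by move=> Ws Wt; exact: (fs_comb hV c Ws Wt).
have comb1 u (s t : (T -> R) * R) y : (u *: s + t).1 y = u * s.1 y + t.1 y.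
  by [].
have comb2 u (s t : (T -> R) * R) : (u *: s + t).2 = u * s.2 + t.2 by [].
have lin y c : linear_on W (fun gc => gc.1 y - gc.2 * c).
  by move=> u s t _ _; rewrite comb1 comb2; ring.
split.
  have [||[w [w0 wP cw]]|] := @farkas R _ W W0 WD _ (fun j => `[< C i (a j) >])
    (fun j gc => gc.1 (a j) - gc.2 * h j) (fun gc => gc.1 x - gc.2 * v).
  - by move=> j; exact: lin.
  - exact: lin.
  - exists w.
      split.
      + split=> //; have := cw (cst 1, 0) (fs_cst hV 1) => /=.
        rewrite mul0r subr0 => ->; apply: eq_bigr => j _.
        by rewrite mul0r subr0 mulr1.
      + move=> j wj; apply: contrapT => nC; move: wj.
        by rewrite wP ?eqxx //; exact/asboolPn.
      + move=> f Vf; have := cw (f, 0) Vf => /=; rewrite mul0r subr0 => ->.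
        by apply: eq_bigr => j _; rewrite mul0r subr0.
    have := cw (cst 0, -1) (fs_cst hV 0) => /=.
    rewrite sub0r mulN1r opprK => ->; apply: eq_bigr => j _.
    by rewrite sub0r mulN1r opprK.
  - move=> [[g c] [/= Vg hg gx]]; exfalso; rewrite subr_lt0 in gx.
    have gh w : marked_combination i x w -> c * \sum_j w j * h j <= g x.
      move=> [[w0 _] wC cw]; have -> := cw g Vg; rewrite mulr_sumr.
      apply: ler_sum => j _; have [->|wj] := eqVneq (w j) 0.
        by rewrite !mul0r mulr0.
      rewrite mulrCA ler_wpM2l // -subr_ge0; apply: hg.
      by apply/asboolP/wC.
    have [c0|c0] := ltP 0 c.
      suff : v <= g x / c by rewrite leNgt ltr_pdivrMr // mulrC gx.
      apply: sup_le_ub; first by case: supE.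
      by move=> _ [w cw <-]; rewrite ler_pdivlMr // mulrC gh.
    have := le_lt_trans (gh _ cw1) gx.
    by rewrite ltNge ler_wnM2l // Ev.
(* Index [ord0] carries the condition [g x <= c * v]; the separated functional
   is [(g, c) |-> - c], so that separation means [c > 0]. *)
have [||[u [u0 uP hu]]|[[g c] [/= Vg hg gc]]] := @farkas R _ W W0 WD 'I_N.+1
  (fun o => if unlift ord0 o is Some j then `[< C i (a j) >] else true)
  (fun o gc => if unlift ord0 o is Some j then gc.1 (a j) - gc.2 * h j
               else - (gc.1 x - gc.2 * v)) (fun gc => - gc.2).
- move=> o; case: (unlift ord0 o) => [j|]; first exact: lin.
  by move=> c s t Ws Wt; rewrite (lin x v) //; ring.
- by move=> c s t _ _; rewrite comb2; ring.
- exfalso; pose mu := u ord0; pose la j := u (lift ord0 j).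
  have {}hu g c : V i g ->
      - c = - (mu * (g x - c * v)) + \sum_j la j * (g (a j) - c * h j).
    move=> Vg; have := hu (g, c) Vg; rewrite big_ord_recl unlift_none /= mulrN.
    by move=> ->; congr (_ + _); apply: eq_bigr => j _; rewrite liftK.
  have laC j : la j != 0 -> C i (a j).
    move=> lj; apply: contrapT => nC; move: lj.
    by rewrite /la uP ?eqxx // liftK; exact/asboolPn.
  have lag g : V i g -> mu * g x = \sum_j la j * g (a j).
    move=> Vg; have := hu g 0 Vg; rewrite mul0r subr0 oppr0.
    under eq_bigr do rewrite mul0r subr0.
    by move/esym/eqP; rewrite addrC subr_eq0 => /eqP.
  have la1 : mu = \sum_j la j.
    have := lag _ (fs_cst hV 1); rewrite mulr1 => ->.
    by apply: eq_bigr => j _; rewrite mulr1.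
  have lah : \sum_j la j * h j = mu * v + 1.
    have := hu _ 1 (fs_cst hV 0) => /=; rewrite sub0r mul1r mulrN opprK.
    under eq_bigr do rewrite sub0r mul1r mulrN.
    by rewrite sumrN; lra.
  have := u0 ord0; rewrite -/mu le_eqVlt => /predU1P[mu0|mu0].
    have : \sum_j la j * h j = 0.
      move/esym/eqP: la1; rewrite -mu0 psumr_eq0 => [/allP la0|j _].
        by apply: big1 => j _; rewrite (eqP (la0 j (mem_index_enum j))) mul0r.
      exact: u0.
    by rewrite lah -mu0 mul0r add0r => /eqP; rewrite oner_eq0.
  have /Ev : marked_combination i x (fun j => mu^-1 * la j).
    split.
    + split=> [j|]; first by rewrite mulr_ge0 ?invr_ge0 ?u0.
      by rewrite -mulr_sumr -la1 mulVf ?gt_eqF.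
    + by move=> j; rewrite mulf_eq0 => /norP[_ /laC].
    + move=> g Vg; under eq_bigr do rewrite -mulrA.
      by rewrite -mulr_sumr -lag // mulKf ?gt_eqF.
  under eq_bigr do rewrite -mulrA.
  rewrite -mulr_sumr lah mulrDr mulKf ?gt_eqF // gerDl mulr1.
  by rewrite leNgt invr_gt0 mu0.
have c0 : 0 < c by rewrite -oppr_lt0.
have maj : majorant i (fun y => c^-1 * g y).
  split; first exact: (fs_scale hV).
  move=> j jC; rewrite -(ler_pM2l c0) mulVKf ?gt_eqF //.
  by have := hg (lift ord0 j); rewrite liftK subr_ge0; apply; exact/asboolP.
exists (fun y => c^-1 * g y) => //.
apply/eqP; rewrite eq_le; apply/andP; split.
  rewrite -(ler_pM2l c0) mulVKf ?gt_eqF //.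
  by have := hg ord0; rewrite unlift_none oppr_ge0 subr_le0; apply.
apply: sup_le_ub; first by case: supE.
by move=> _ [w cw <-]; exact: (combination_le_majorant cw maj).
Qed.


End Heights.

(** * The subdivision by contact sets *)

Section HullSubdivision.
Context {R : realType} (D : integral_complex R) (N : nat).
Context (a : 'I_N -> pc_space D) (h : 'I_N -> R).
Implicit Types (i m : pc_idx D) (x y z : pc_space D) (w : 'I_N -> R).
Implicit Types (B : {set 'I_N}).
Local Notation T := (pc_space D).
Local Notation C := (@pc_cell R D).
Local Notation V := (@pc_affine R D).

Hypothesis vertices_marked : forall m x, C m = [set x] -> exists j, a j = x.
Hypothesis marked_rational : forall i j, C i (a j) -> rational_point i (a j).

(** The use of the carrier makes the value independent of a cell; by
    [marked_combination_carrier] any cell through [x] gives the same value, and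
    by [hull_heightP] the supremum is attained. *)
Definition hull_height x : R :=
  sup [set v | exists2 w, marked_combination a (carrier x) x w &
                          \sum_j w j * h j = v].

Lemma hull_heightP i x : C i x ->
  (exists2 w, marked_combination a i x w & \sum_j w j * h j = hull_height x) /\
  (exists2 l, majorant a h i l & l x = hull_height x).
Proof.
move=> Cx; have [v [[w cw wv] [l ml lx]]] := height_duality h vertices_marked Cx.
suff -> : hull_height x = v by split; [exists w|exists l].
have ubv : ubound [set v | exists2 w, marked_combination a (carrier x) x w &
    \sum_j w j * h j = v] v.
  move=> _ [w' /(marked_combination_carrier a w' Cx) cw' <-].
  by rewrite -lx; exact: combination_le_majorant cw' ml.
have vin : [set v | exists2 w, marked_combination a (carrier x) x w &
    \sum_j w j * h j = v] v.
  by exists w => //; exact/(marked_combination_carrier a w Cx).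
apply/eqP; rewrite eq_le; apply/andP; split.
  by apply: sup_le_ub => //; exists v.
by apply: sup_upper_bound => //; split; exists v.
Qed.

Lemma combination_le_hull i x w : C i x -> marked_combination a i x w ->
  \sum_j w j * h j <= hull_height x.
Proof.
move=> Cx cw; have [_ [l ml <-]] := hull_heightP Cx.
exact: combination_le_majorant cw ml.
Qed.

Lemma hull_le_majorant i x l : C i x -> majorant a h i l -> hull_height x <= l x.
Proof.
move=> Cx ml; have [[w cw <-] _] := hull_heightP Cx.
exact: combination_le_majorant cw ml.
Qed.

Lemma height_le_hull j : h j <= hull_height (a j).
Proof.
have Ca := carrier_cell (a j).
suff cd : marked_combination a (carrier (a j)) (a j) (fun l => (l == j)%:R).
  by have := combination_le_hull Ca cd; rewrite sum_delta.
split; first exact: weights_delta.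
  by move=> l; have [-> //|_] := eqVneq l j; rewrite eqxx.
by move=> f _; rewrite sum_delta.
Qed.

Definition contact i (l : T -> R) : set T :=
  C i `&` [set x | hull_height x = l x].

Definition tight i (l : T -> R) : {set 'I_N} :=
  [set j | `[< C i (a j) >] && (l (a j) == h j)].

Lemma tightP i l j : reflect (C i (a j) /\ l (a j) = h j) (j \in tight i l).
Proof.
apply: (iffP idP); rewrite inE.
  by move=> /andP[/asboolP ? /eqP].
by move=> [? ->]; apply/andP; split; [apply/asboolP|].
Qed.

Lemma tight_contact i l j : majorant a h i l -> C i (a j) -> l (a j) = h j ->
  contact i l (a j).
Proof.
move=> ml Ca lj; split=> //=; apply/eqP; rewrite eq_le (hull_le_majorant Ca ml).
by rewrite lj height_le_hull.
Qed.

(** At a point of contact a highest combination cannot use any point over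
    which the majorant lies strictly above the height. *)
Lemma contact_attained i l x : majorant a h i l -> contact i l x ->
  exists w, [/\ marked_combination a i x w, \sum_j w j * h j = hull_height x &
                forall j, w j != 0 -> C i (a j) /\ l (a j) = h j].
Proof.
move=> [Vl hl] [Cx /= fx]; have [[w cw whx] _] := hull_heightP Cx.
exists w; split=> // j wj; have [[w0 _] wC cwV] := cw.
split; first exact: wC.
apply/eqP; rewrite -subr_eq0; apply/eqP.
apply: (@weighted_sum_eq0 _ _ w (fun j => l (a j) - h j)) => //.
  by move=> j' /wC; rewrite subr_ge0; exact: hl.
under eq_bigr do rewrite mulrBr.
by rewrite sumrB whx fx (cwV _ Vl) subrr.
Qed.

Definition marked_hull i B : set T :=
  [set x | C i x /\ exists w, [/\ weights w, forall j, w j != 0 -> j \in B &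
                                 combination (V i) a w x]].

Lemma contact_hull i l : majorant a h i l ->
  contact i l = marked_hull i (tight i l).
Proof.
move=> ml; apply/seteqP; split=> x.
  move=> cx; have [w [[hw _ cw] _ wt]] := contact_attained ml cx.
  split; first by case: cx.
  by exists w; split=> // j /wt ?; exact/tightP.
move=> [Cx [w [hw wt cw]]]; split=> //=; apply/eqP; rewrite eq_le.
have [Vl _] := ml.
rewrite (hull_le_majorant Cx ml) (cw _ Vl).
have -> : \sum_j w j * l (a j) = \sum_j w j * h j.
  apply: eq_bigr => j _; have [->|wj] := eqVneq (w j) 0; first by rewrite !mul0r.
  by have /tightP[_ ->] := wt j wj.
apply: (combination_le_hull Cx); split=> // j /wt.
by move=> /tightP[].
Qed.

(** Translation from weights on all marked points, supported in [B], to weights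
    on an enumeration of [B]. *)
Lemma marked_hull_enum i B : B != finset.set0 ->
  exists n (e : 'I_n.+1 -> 'I_N), [/\ forall r, e r \in B,
    marked_hull i B = hull_in (C i) (V i) (a \o e) &
    independent_on (V i) B a -> affinely_independent (V i) (a \o e)].
Proof.
rewrite -cards_eq0; case En : #|B| => [//|n] _.
have [e [einj eB esum]] : exists e : 'I_n.+1 -> 'I_N,
    [/\ injective e, forall r, e r \in B &
     forall F : 'I_N -> R, (forall j, j \notin B -> F j = 0) ->
       \sum_j F j = \sum_r F (e r)].
  rewrite -En; exists enum_val; split=> [|r|F F0].
  - exact: enum_val_inj.
  - exact: enum_valP.
  rewrite (bigID (mem B)) /= [X in _ + X]big1 // addr0.
  exact: big_enum_val.
pose push (v : 'I_n.+1 -> R) j := \sum_r v r * (e r == j)%:R.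
have pushB v j : j \notin B -> push v j = 0.
  move=> jB; apply: big1 => r _; case: eqP (eB r) jB => [->|_ _ _].
    by move=> ->.
  by rewrite mulr0.
have push_sum v F : \sum_j push v j * F j = \sum_r v r * F (e r).
  rewrite esum => [|j /pushB ->]; last by rewrite mul0r.
  apply: eq_bigr => r _; congr (_ * _).
  rewrite /push (bigD1 r) //= eqxx mulr1 big1 ?addr0 //.
  by move=> r' /negbTE rr'; rewrite (inj_eq einj) rr' mulr0.
exists n, e; split=> //.
  apply/seteqP; split=> x [Cx].
    move=> [w [[w0 w1] wB cw]]; split=> //; have w0B j : j \notin B -> w j = 0.
      by move=> jB; apply/eqP; apply: contraNT jB; exact: wB.
    exists (w \o e); first by split=> [r|]; [exact: w0|rewrite -w1 esum].
    move=> f Vf; rewrite (cw _ Vf) esum // => j jB.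
    by rewrite w0B // mul0r.
  move=> [v [v0 v1] cv]; split=> //; exists (push v); split.
  - split=> [j|]; first by apply: sumr_ge0 => r _; rewrite mulr_ge0.
    have := push_sum v (fun=> 1); under eq_bigr do rewrite mulr1.
    by move=> ->; under eq_bigr do rewrite mulr1.
  - by move=> j; apply: contraNT => /pushB ->.
  - by move=> f Vf; rewrite push_sum; exact: cv.
move=> ind v hv r; have := ind (push v) (pushB v) _ (e r).
rewrite /push (bigD1 r) //= eqxx mulr1 big1 ?addr0; last first.
  by move=> r' /negbTE rr'; rewrite (inj_eq einj) rr' mulr0.
by apply=> f Vf; rewrite push_sum; exact: hv.
Qed.

Lemma marked_hull_neq0 i B x : marked_hull i B x -> B != finset.set0.
Proof.
move=> [_ [w [[w0 w1] wB _]]]; apply/eqP => B0.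
have : \sum_j w j = 0.
  apply: big1 => j _; apply/eqP; apply: contraT => /wB.
  by rewrite B0 inE.
by rewrite w1 => /eqP; rewrite oner_eq0.
Qed.

Lemma contact_rational_polytope i l : majorant a h i l ->
  contact i l !=set0 -> rational_polytope_in i (contact i l).
Proof.
move=> ml [x]; rewrite contact_hull // => /marked_hull_neq0 B0.
have [n [e [eB -> _]]] := marked_hull_enum i B0.
exists n, (a \o e); split=> // r; apply: marked_rational.
by have /tightP[] := eB r.
Qed.

Lemma contact_simplex i l : majorant a h i l -> contact i l !=set0 ->
  independent_on (V i) (tight i l) a -> simplex_in i (contact i l).
Proof.
move=> ml [x]; rewrite contact_hull // => /marked_hull_neq0 B0 ind.
have [n [e [eB -> ei]]] := marked_hull_enum i B0.
exists n, (a \o e); split=> //; last exact: ei.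
by move=> r; have /tightP[] := eB r.
Qed.

Lemma contact_sub i l : contact i l `<=` C i.
Proof. by move=> x []. Qed.

Lemma contact_inner_point i l : majorant a h i l -> contact i l !=set0 ->
  exists x, inner_point (V i) (contact i l) x.
Proof.
move=> ml /(contact_rational_polytope ml)/rational_polytope_in_polytope.
by case/polytope_inner_point.
Qed.

(** A contact set lies in the carrier of an inner point; a multiple of the
    function that cuts this face out of [C m] lifts the majorant off the other
    marked points of [C m]. *)
Lemma contact_transfer i m l : majorant a h i l -> contact i l !=set0 ->
  contact i l `<=` C m ->
  exists2 l', majorant a h m l' & contact m l' = contact i l.
Proof.
move=> ml ne tm; have [x0 inn] := contact_inner_point ml ne.
have tc := inner_point_carrier (@contact_sub i l) inn.
have fi := carrier_face (contact_sub inn.1).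
have fm := carrier_face (tm _ inn.1); set c := carrier x0 in tc fi fm.
have [g Vg lg] := face_extend fm (face_restrict fi ml.1).
have [_ [k Vk [k0 Ek]]] := fm; have hV := affine_space m.
have [||M M0 hM] := @dominated_perturbation R 'I_N (fun j => C m (a j))
  (fun j => k (a j)) (fun j => g (a j) - h j).
- by move=> j; exact: k0.
- move=> j jm kj; have cj : C c (a j) by rewrite Ek.
  by rewrite -lg // subr_ge0; apply: ml.2; exact: (face_sub fi).
have ml' : majorant a h m (fun x => M * k x + g x).
  split; first exact: (fs_comb hV).
  by move=> j /hM[+ _]; rewrite addrA subr_ge0.
exists (fun x => M * k x + g x) => //; apply/seteqP; split=> x.
  move=> cx; have [w [[hw wC cw] _ wt]] := contact_attained ml' cx.
  have kx : k x = 0.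
    rewrite (cw _ Vk) big1 // => j _; have [->|wj] := eqVneq (w j) 0.
      by rewrite mul0r.
    have [jm e] := wt j wj; have [_] := hM j jm.
    by rewrite addrA e subrr => /(_ erefl)[-> _]; rewrite mulr0.
  have [mx _] := cx.
  have xc : C c x by rewrite Ek.
  split; first exact: (face_sub fi).
  rewrite /= lg //.
  by case: cx => _ /= ->; rewrite kx mulr0 add0r.
move=> tx; have cx := tc _ tx; split; first exact: tm.
have kx : k x = 0 by move: cx; rewrite Ek => -[].
by case: tx => _ /= ->; rewrite kx mulr0 add0r lg.
Qed.

(** Majorants may touch along a set of any dimension, so the nonempty contact
    sets are all faces of the domains of linearity. *)
Definition hull_cells (J : set (pc_idx D)) : set (set T) :=
  [set t | t !=set0 /\ exists i l, [/\ J i, majorant a h i l & t = contact i l]].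

Lemma hull_cells_in J i t : hull_cells J t -> t `<=` C i ->
  exists2 l, majorant a h i l & t = contact i l.
Proof.
move=> [ne [m [l [_ ml tE]]]] ti; move: ne ti; rewrite tE => ne ti.
by have [l' ml' <-] := contact_transfer ml ne ti; exists l'.
Qed.

(** Tilting the majorant [l] slightly by the function [k] that cuts out the
    face keeps it above the heights and only keeps the face in contact. *)
Lemma contact_face i l t : majorant a h i l -> face_of (V i) t (contact i l) ->
  exists2 l', majorant a h i l' & t = contact i l'.
Proof.
move=> ml [_ [k Vk [k0 ->]]]; have hV := affine_space i; have [Vl hl] := ml.
have [||M M0 hM] := @dominated_perturbation R 'I_N (fun j => C i (a j))
  (fun j => l (a j) - h j) (fun j => k (a j)).
- by move=> j ij; rewrite subr_ge0; exact: hl.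
- move=> j ij /eqP; rewrite subr_eq0 => /eqP lj; apply: k0.
  exact: tight_contact.
pose l' x := M^-1 * k x + l x.
have l'E y : M * (l' y) = M * l y + k y.
  by rewrite /l' mulrDr mulVKf ?gt_eqF // addrC.
have ml' : majorant a h i l'.
  split; first exact: (fs_comb hV).
  move=> j /hM[hj _]; rewrite -(ler_pM2l M0) l'E; lra.
exists l' => //; apply/seteqP; split=> x.
  by move=> [[ix /= fx] kx]; split=> //; rewrite /= /l' kx mulr0 add0r.
move=> cx; have [w [[hw wC cw] wh wt]] := contact_attained ml' cx.
have wlk j : w j != 0 -> l (a j) = h j /\ k (a j) = 0.
  move=> /wt[ij e]; have [_] := hM j ij.
  have -> : M * (l (a j) - h j) + k (a j) = 0.
    by have := l'E (a j); rewrite e; lra.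
  by move=> /(_ erefl)[/eqP]; rewrite subr_eq0 => /eqP.
split; first split; first by case: cx.
  rewrite /= -wh (cw _ Vl); apply: eq_bigr => j _.
  by have [->|/wlk[->]] := eqVneq (w j) 0; rewrite ?mul0r.
rewrite /= (cw _ Vk) big1 // => j _.
by have [->|/wlk[_ ->]] := eqVneq (w j) 0; rewrite ?mul0r ?mulr0.
Qed.

(** The difference of two majorants is nonnegative where one of them is in
    contact, and it vanishes where both are. *)
Lemma contact_meet_face i l l' : majorant a h i l -> majorant a h i l' ->
  contact i l `&` contact i l' !=set0 ->
  face_of (V i) (contact i l `&` contact i l') (contact i l).
Proof.
move=> ml ml' ne; split=> //; exists (fun x => l' x - l x).
  by apply: (fs_sub (affine_space i)); [exact: ml'.1|exact: ml.1].
split.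
  move=> x [ix /= fx]; rewrite subr_ge0 -fx; exact: hull_le_majorant ml'.
apply/seteqP; split=> x.
  by move=> [[ix /= fx] [_ /= fx']]; split=> //=; rewrite -fx -fx' subrr.
move=> [[ix /= fx] /eqP]; rewrite subr_eq0 => /eqP e.
by split=> //; split=> //=; rewrite e.
Qed.

(** A contact set is determined by its cell and its tight marked points. *)
Lemma hull_cells_finite J : finite_set (hull_cells J).
Proof.
apply: (@sub_finite_set _ _
  [set marked_hull iB.1 iB.2 | iB in [set: pc_idx D * {set 'I_N}]]).
  move=> t [_ [i [l [_ ml ->]]]]; exists (i, tight i l) => //=.
  by rewrite contact_hull.
by apply: finite_image; exact: finite_finset.
Qed.

Lemma hull_subdivision J : subdivision J (hull_cells J).
Proof.
split.
- exact: hull_cells_finite.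
- move=> t [ne [i [l [Ji ml tE]]]]; exists i => //.
  by move: ne; rewrite tE; exact: contact_rational_polytope.
- move=> i t t' Ji St ti; have [l ml ->] := hull_cells_in St ti.
  move=> ft; have [l' ml' e] := contact_face ml ft.
  by split; [exact: ft.1 | exists i, l'].
- move=> i t t' Ji St St' ti t'i.
  have [l ml ->] := hull_cells_in St ti.
  have [l' ml' ->] := hull_cells_in St' t'i => ne.
  split; first exact: contact_meet_face.
  by rewrite setIC; apply: contact_meet_face => //; rewrite setIC.
apply/seteqP; split=> [x [t [_ [i [l [Ji ml ->]]]] [ix _]]|x [i Ji ix]].
  by exists i.
have [_ [l ml lx]] := hull_heightP ix.
exists (contact i l); last by split.
by split; [exists x; split|exists i, l].
Qed.

End HullSubdivision.

(** * Comparison of subdivisions *)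

Section Refinement.
Context {R : realType} (D : integral_complex R).
Implicit Types (J : set (pc_idx D)) (S : set (set (pc_space D))).
Implicit Types (f g : pc_space D -> R).

Lemma subdivision_cell J S t : subdivision J S -> S t ->
  exists i, [/\ J i, t `<=` pc_cell i & exists x, inner_point (pc_affine i) t x].
Proof.
move=> [_ rp _ _ _] St; have [i Ji /rational_polytope_in_polytope pt] := rp t St.
by have [ti inn] := polytope_inner_point pt; exists i.
Qed.

Lemma linear_on_cells_eq J S f g :
  (forall i x, J i -> pc_cell i x -> f x = g x) ->
  linear_on_cells J S f -> linear_on_cells J S g.
Proof.
move=> fg lf t /lf[i [Ji ti [k Vk fk]]]; exists i; split=> //.
by exists k => // x tx; rewrite -fk // (fg i) //; exact: ti.
Qed.

(** If [t] is in [S1], [t'] in [S2] and [t''] in [S1] with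
    [t <= t' <= t''], then [t] is a face of [t''], hence of [t']. *)
Lemma mutual_refinement J S1 S2 : subdivision J S1 -> subdivision J S2 ->
  subdivision_refines S1 S2 -> subdivision_refines S2 S1 -> S1 `<=` S2.
Proof.
move=> d1 d2 r12 r21 t S1t.
have [t' S2t' tt'] := r12 t S1t; have [t'' S1t'' t't''] := r21 t' S2t'.
have [i [Ji t''i _]] := subdivision_cell d1 S1t''.
have [_ _ _ meet _] := d1; have [_ _ face _ _] := d2.
have tt'' : t `<=` t'' by move=> x /tt' /t't''.
have tI : t `&` t'' = t by apply/seteqP; split=> [x []|x tx] //; split=> //; exact: tt''.
have [_ [_ _ [x [tx _]]]] := subdivision_cell d1 S1t.
have [|||_ ft] := meet i t t'' Ji S1t S1t''.
- by move=> y /tt'' /t''i.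
- exact: t''i.
- by rewrite tI; exists x.
move: ft; rewrite tI => -[ne [k Vk [k0 tE]]].
apply: (face i t') => //; first by move=> y /t't'' /t''i.
split=> //; exists k => //; split=> [y /t't''|]; first exact: k0.
apply/seteqP; split=> y.
  by move=> ty; split; [exact: tt'|move: ty; rewrite tE => -[]].
by move=> [/t't'' ty ky]; rewrite tE.
Qed.

(** A cell [t] of [S2] has an inner point lying in some [t'] of [S1]; as [t']
    also belongs to [S2], the intersection of [t] and [t'] is a face of [t]
    through an inner point, that is [t] itself. So [S2] refines [S1]. *)
Lemma subdivision_sub_eq J S1 S2 :
  subdivision J S1 -> subdivision J S2 -> S1 `<=` S2 -> S1 = S2.
Proof.
move=> d1 d2 s12; apply/seteqP; split=> //.
apply: (mutual_refinement d2 d1) => t; last by move=> /s12 S2t; exists t.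
move=> S2t; have [i [Ji ti [x inn]]] := subdivision_cell d2 S2t.
have [_ _ _ _ cov1] := d1; have [_ _ _ meet _] := d2.
have : polyhedron J x by exists i => //; exact: ti inn.1.
rewrite -cov1 => -[t' S1t' t'x]; exists t' => //.
have [m [Jm t'm _]] := subdivision_cell d1 S1t'.
have tm : t `<=` pc_cell m.
  by move=> y /(inner_point_carrier ti inn) /(face_sub (carrier_face (t'm _ t'x))).
have innm := inner_point_transfer ti inn tm.
have [|[_ [k Vk [k0 tE]]] _] := meet m t t' Jm S2t (s12 _ S1t') tm t'm.
  by exists x; split=> //; exact: inn.1.
move=> y ty; suff : (t `&` t') y by case.
rewrite tE; split=> //=; apply: innm.2 => //.
have : (t `&` t') x by split=> //; exact: inn.1.
by rewrite tE => -[].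
Qed.

End Refinement.

(** * The hull height as a lifting function *)

Section HullHeightLifting.
Context {R : realType} (D : integral_complex R) (N : nat).
Context (a : 'I_N -> pc_space D) (h : 'I_N -> R).
Implicit Types (i m : pc_idx D) (x y z : pc_space D) (J : set (pc_idx D)).
Local Notation T := (pc_space D).
Local Notation C := (@pc_cell R D).
Local Notation V := (@pc_affine R D).

Hypothesis vertices_marked : forall m x, C m = [set x] -> exists j, a j = x.
Hypothesis marked_rational : forall i j, C i (a j) -> rational_point i (a j).

Local Notation hh := (hull_height a h).
Local Notation hull_cells := (hull_cells a h).

Lemma hull_cells_linear J : linear_on_cells J (hull_cells J) hh.
Proof.
move=> t [_ [i [l [Ji [Vl _] ->]]]]; exists i; split=> //.
  exact: contact_sub.
by exists l => // x [].
Qed.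

(** A majorant that touches the hull height at an inner point of a cell on
    which the hull height is affine touches it on the whole cell. *)
Lemma linear_subdivision_refines J S : subdivision J S ->
  linear_on_cells J S hh -> subdivision_refines S (hull_cells J).
Proof.
move=> dS lS t St; have [m [_ tm [x innm]]] := subdivision_cell dS St.
have [i [Ji ti [g Vg hg]]] := lS t St.
have inn := inner_point_transfer tm innm ti; have ix := ti _ inn.1.
have [_ [l ml lx]] := hull_heightP h vertices_marked ix.
exists (contact a h i l).
  by split; [exists x; split|exists i, l].
have hV := affine_space i.
move=> y ty; split; first exact: ti.
have /= := inn.2 _ (fs_sub hV ml.1 Vg) _ _ y ty; rewrite hg //.
move=> e; apply/esym/eqP; rewrite -subr_eq0; apply/eqP/e.
  move=> z tz; rewrite subr_ge0 -hg //.
  by apply: hull_le_majorant ml => //; exact: ti.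
by rewrite lx hg ?subrr //; exact: inn.1.
Qed.

Lemma hull_induced J : induced_by J (hull_cells J) hh.
Proof.
split; first exact: hull_subdivision.
- exact: hull_cells_linear.
- exact: linear_subdivision_refines.
Qed.

Lemma hull_piecewise_linear i : piecewise_linear_on_cell i hh.
Proof.
have /finite_seqP[s sE] := hull_cells_finite h vertices_marked [set i].
have sP t : t \in s -> exists2 l, majorant a h i l &
    t !=set0 /\ t = contact a h i l.
  move=> ts; have : hull_cells [set i] t by rewrite sE.
  by move=> [ne [m [l [-> ml tE]]]]; exists l.
exists (size s), (fun j => nth set0 s j); split=> [j||j].
- have [l ml [ne tE]] := sP _ (mem_nth set0 (ltn_ord j)).
  rewrite tE; apply/rational_polytope_in_polytope/contact_rational_polytope => //.
  by rewrite -tE.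
- apply/seteqP; split=> x.
    move=> [j _]; have [l ml [_ ->]] := sP _ (mem_nth set0 (ltn_ord j)).
    exact: contact_sub.
  move=> ix; have [_ [l ml lx]] := hull_heightP h vertices_marked ix.
  have : hull_cells [set i] (contact a h i l).
    by split; [exists x; split|exists i, l].
  rewrite sE /= => ts; have js := ts; rewrite -index_mem in js.
  by exists (Ordinal js) => //=; rewrite nth_index.
- have [l [Vl _] [_ tE]] := sP _ (mem_nth set0 (ltn_ord j)).
  by exists l => //; rewrite tE => x [].
Qed.

Lemma hull_convex_down i : convex_down_on_cell i hh.
Proof.
move=> x y z la mu ix iy iz la0 mu0 _ zE.
have [_ [l ml <-]] := hull_heightP h vertices_marked iz.
rewrite (zE _ ml.1); apply: lerD; rewrite ler_wpM2l //;
  exact: hull_le_majorant ml.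
Qed.

Let dist_min_lt (e u u' v v' : R) : `|u - u'| < e -> `|v - v'| < e ->
  v' <= u' -> u <= v -> `|u - v'| < e.
Proof.
rewrite !ltr_norml => /andP[? ?] /andP[? ?] ? ?.
by apply/andP; split; lra.
Qed.

(** On a cell the hull height is the minimum of finitely many majorants, one
    for each set of tight marked points. *)
Lemma hull_continuous_cell i : {within C i, continuous hh}.
Proof.
have hV := affine_space i.
have /choice[L hL] : forall B : {set 'I_N}, exists l, V i l /\
    ((exists2 l', majorant a h i l' & tight a h i l' = B) ->
     majorant a h i l /\ tight a h i l = B).
  move=> B; have [[l ml tl]|nB] := pselect (exists2 l', majorant a h i l' &
      tight a h i l' = B).
    by exists l; split; [exact: ml.1|].
  by exists (cst 0); split; [exact: fs_cst hV 0|].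
pose good B := majorant a h i (L B).
have min x : C i x -> exists2 B, good B & hh x = L B x.
  move=> ix; have [_ [l ml lx]] := hull_heightP h vertices_marked ix.
  have [_ [|mB tB]] := hL (tight a h i l); first by exists l.
  exists (tight a h i l) => //.
  have := contact_hull vertices_marked mB.
  rewrite tB -(contact_hull vertices_marked ml) => e.
  have : contact a h i l x by split.
  by rewrite -e => -[].
have le B x : good B -> C i x -> hh x <= L B x.
  by move=> gB ix; exact: hull_le_majorant gB.
apply/subspace_continuousP => x ix; apply/cvgrPdist_lt => e e0.
have near_L : \forall y \near within (C i) (nbhs x), forall B, `|L B x - L B y| < e.
  apply: filter_forall => B.
  have [VB _] := hL B.
  have /subspace_continuousP/(_ x ix)/cvgrPdist_lt := affine_continuous VB.
  exact.
have near_C : \forall y \near within (C i) (nbhs x), C i y by exact: withinT.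
apply: filterS2 near_L near_C => y Ly iy.
have [Bx gx hx] := min x ix; have [By gy hy] := min y iy.
suff : `|L Bx x - L By y| < e by rewrite -hx -hy.
apply: (dist_min_lt (Ly Bx) (Ly By)); first by rewrite -hy; exact: le.
by rewrite -hx; exact: le.
Qed.

Lemma hull_continuous : {within polyhedron setT, continuous hh}.
Proof.
have -> : polyhedron setT = \big[setU/set0]_(i <- enum (pc_idx D)) C i.
  rewrite -bigcup_seq; apply/seteqP; split=> x [i _ ix]; exists i => //=.
  by rewrite mem_enum.
elim: (enum _) => [|i s IH]; first by rewrite big_nil; exact: continuous_subspace0.
rewrite big_cons; apply: withinU_continuous => //.
- exact: cell_closed.
- by apply: closed_bigsetU => m _; exact: cell_closed.
- exact: hull_continuous_cell.
Qed.

End HullHeightLifting.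

(** * Rational values *)

Section Rationality.
Context {R : realType} (D : integral_complex R) (N : nat).
Context (a : 'I_N -> pc_space D).
Implicit Types (i : pc_idx D) (x : pc_space D) (B : {set 'I_N}).

Lemma rational_sum n (u : 'I_n -> R) :
  (forall j, rational (u j)) -> rational (\sum_j u j).
Proof.
move=> hu; have /choice[q hq] : forall j, exists q : rat, ratr q = u j.
  by move=> j; have [q _ e] := hu j; exists q.
by exists (\sum_j q j) => //; rewrite rmorph_sum; apply: eq_bigr => j _; exact: hq.
Qed.

Lemma rational_mul (u v : R) : rational u -> rational v -> rational (u * v).
Proof. by move=> [p _ <-] [q _ <-]; exists (p * q) => //; rewrite rmorphM. Qed.

Lemma rational_add (u v : R) : rational u -> rational v -> rational (u + v).
Proof. by move=> [p _ <-] [q _ <-]; exists (p + q) => //; rewrite rmorphD. Qed.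

(** The weights solve a linear system with rational coefficients, whose
    solution is unique by independence. A system that is solvable over [R] is
    solvable over the rationals. *)
Lemma rational_weights i B x (w : 'I_N -> R) :
  independent_on (pc_affine i) B a ->
  (forall j, j \in B -> rational_point i (a j)) -> rational_point i x ->
  (forall j, w j != 0 -> j \in B) -> combination (pc_affine i) a w x ->
  forall j, rational (w j).
Proof.
move=> ind ra rx wB cw; have [n [e [[eV espan eind] LE]]] := integral_lattice i.
have eL r : pc_integral i (e r).
  apply/LE; exists (fun r' => (r' == r)%:R) => y _.
  rewrite -(sum_delta r (fun r => e r y)); apply: eq_bigr => r' _.
  by rewrite rmorph_nat.
have /choice[A hA] : forall jr : 'I_N * 'I_n, exists q : rat,
    jr.1 \in B -> ratr q = e jr.2 (a jr.1).
  move=> [j r] /=; have [jB|] := boolP (j \in B); last by exists 0.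
  by have [_ /(_ _ (eL r))[q _ qE]] := ra j jB; exists q.
have /choice[b hb] : forall r, exists q : rat, ratr q = e r x.
  by move=> r; have [_ /(_ _ (eL r))[q _ qE]] := rx; exists q.
pose Am : 'M[rat]_(N, n) := \matrix_(j, r) if j \in B then A (j, r) else 0.
pose bm : 'rV[rat]_n := \row_r b r.
have Ae j r : j \in B -> ratr (Am j r) = e r (a j).
  by move=> jB; rewrite mxE jB (hA (j, r)).
have : (map_mx (@ratr R) bm <= map_mx (@ratr R) Am)%MS.
  apply/submxP; exists (\row_j w j); apply/rowP => r; rewrite !mxE hb.
  rewrite (cw _ (eV r)); apply: eq_bigr => j _; rewrite [in RHS]mxE [in RHS]mxE.
  have [->|/wB jB] := eqVneq (w j) 0; first by rewrite !mul0r.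
  by rewrite Ae.
rewrite map_submx => /submxP[u uE].
have wu j : w j - (if j \in B then ratr (u ord0 j) else 0) = 0.
  move: j; apply: ind => [j jB|f Vf].
    rewrite (negbTE jB) subr0; apply/eqP; apply: contraNT jB; exact: wB.
  under eq_bigr do rewrite mulrBl.
  rewrite sumrB -(cw _ Vf).
  have [c fc] := espan f Vf.
  have -> : \sum_j (if j \in B then ratr (u ord0 j) else 0) * f (a j) =
      \sum_r c r * \sum_j (if j \in B then ratr (u ord0 j) else 0) * e r (a j).
    under [RHS]eq_bigr do rewrite mulr_sumr.
    rewrite exchange_big /=; apply: eq_bigr => j _.
    case: ifP => jB; last first.
      by rewrite mul0r big1 // => r _; rewrite mul0r mulr0.
    rewrite fc; last by case: (ra j jB).
    by rewrite mulr_sumr; apply: eq_bigr => r _; rewrite mulrCA.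
  rewrite fc; last by case: rx.
  rewrite -sumrB big1 // => r _.
  have -> : e r x = \sum_j (if j \in B then ratr (u ord0 j) else 0) * e r (a j).
    rewrite -hb; have := congr1 (fun M : 'rV_n => ratr (M ord0 r) : R) uE.
    rewrite !mxE => ->; rewrite rmorph_sum; apply: eq_bigr => j _.
    rewrite rmorphM /=; case: ifP => jB; first by rewrite Ae.
    by rewrite mxE jB rmorph0 mulr0 mul0r.
  by rewrite subrr.
move=> j; have /eqP := wu j; rewrite subr_eq0 => /eqP ->.
case: ifP => _; first by exists (u ord0 j).
by exists 0 => //; rewrite rmorph0.
Qed.

Lemma hull_height_rational (h : 'I_N -> R) i x :
  (forall m x, pc_cell m = [set x] -> exists j, a j = x) ->
  (forall m j, pc_cell m (a j) -> rational_point m (a j)) ->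
  (forall j, rational (h j)) ->
  (forall l, majorant a h i l -> independent_on (pc_affine i) (tight a h i l) a) ->
  rational_point i x -> rational (hull_height a h x).
Proof.
move=> vm mr hrat ind rx; have ix := rx.1.
have [_ [l ml lx]] := hull_heightP h vm ix.
have cx : contact a h i l x by split.
have [w [[_ wC cw] <- wt]] := contact_attained vm ml cx.
apply: rational_sum => j; apply: rational_mul => //.
apply: (rational_weights (ind l ml)) cw j => //.
  by move=> j /tightP[] /mr.
by move=> j /wt ?; exact/tightP.
Qed.

End Rationality.

(** * Generic heights *)

Section Perturbation.
Context {R : realType} (D : integral_complex R) (N : nat).
Context (a : 'I_N -> pc_space D) (h0 : 'I_N -> R).
Implicit Types (i : pc_idx D) (x : pc_space D) (B : {set 'I_N}).
Local Notation T := (pc_space D).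
Local Notation C := (@pc_cell R D).
Local Notation V := (@pc_affine R D).

(** Distinct powers of [1 / (n + 1)] make every nontrivial linear condition on
    the heights a nonzero polynomial equation in [1 / (n + 1)]. *)
Definition perturbed_height (n : nat) (j : 'I_N) : R :=
  h0 j + n.+1%:R^-1 ^+ j.+1.

Lemma perturbed_height_rational n :
  (forall j, rational (h0 j)) -> forall j, rational (perturbed_height n j).
Proof.
move=> hr j; apply: rational_add => //.
by exists (n.+1%:R^-1 ^+ j.+1) => //; rewrite rmorphXn fmorphV rmorph_nat.
Qed.

(** For each cell and each set [B] of marked points that is affinely dependent
    in it, fix one nontrivial dependence [c]. If [B] were the tight set of a
    majorant [l], the heights would agree with [l] on [B], and the
    [c]-combination of the heights would vanish. *)
Lemma perturbed_generic n0 : exists2 n, (n0 <= n)%N & forall i l,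
  majorant a (perturbed_height n) i l ->
  independent_on (V i) (tight a (perturbed_height n) i l) a.
Proof.
pose ann i B (c : 'I_N -> R) := [/\ forall j, j \notin B -> c j = 0,
  forall f, V i f -> \sum_j c j * f (a j) = 0 & exists j, c j != 0].
pose P (c : 'I_N -> R) : {poly R} :=
  (\sum_j c j * h0 j)%:P + \sum_(j < N) c j *: 'X^(j.+1).
have PE c n : (P c).[n.+1%:R^-1] = \sum_j c j * perturbed_height n j.
  rewrite /P hornerD hornerC horner_sum -big_split /=.
  by apply: eq_bigr => j _; rewrite hornerZ hornerXn mulrDr.
have P0 c : (exists j, c j != 0) -> P c != 0.
  move=> [j cj]; apply: contra_neq cj => Pc0.
  have := congr1 (fun p : {poly R} => p`_(j.+1)) Pc0.
  rewrite coef0 coefD coefC /= add0r coef_sum (bigD1 j) //= coefZ coefXn eqxx.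
  rewrite mulr1 big1 ?addr0 // => l lj; rewrite coefZ coefXn eqSS.
  by rewrite val_eqE eq_sym (negbTE lj) mulr0.
have /choice[p hp] : forall iB : pc_idx D * {set 'I_N}, exists p : {poly R},
    p != 0 /\ ((exists c, ann iB.1 iB.2 c) ->
               exists2 c, ann iB.1 iB.2 c & p = P c).
  move=> [i B] /=; have [[c hc]|nc] := pselect (exists c, ann i B c).
    by exists (P c); split; [apply: P0; case: hc|exists c].
  by exists 1; split; [exact: oner_neq0|].
have [n n0n hn] := common_nonroot n0 (fun iB => (hp iB).1).
exists n => // i l [Vl _]; set B := tight _ _ _ _.
move=> c cB cann j; apply/eqP; apply: contraT => cj.
have [_ [|c' [c'B c'ann _] pE]] := hp (i, B).
  by exists c; split=> //; exists j.
have /eqP := hn (i, B); rewrite pE PE; case; rewrite -[RHS](c'ann _ Vl).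
apply: eq_bigr => j' _; have [/tightP[_ ->] //|/c'B ->] := boolP (j' \in B).
by rewrite !mul0r.
Qed.

(** Affine independence of the tight marked points leaves room to move their
    heights independently: correcting the majorant by dual functions follows
    every small change of heights. *)
Lemma tight_stable i l : majorant a h0 i l ->
  independent_on (V i) (tight a h0 i l) a ->
  exists n0, forall n, (n0 <= n)%N -> exists2 l',
    majorant a (perturbed_height n) i l' &
    tight a (perturbed_height n) i l' = tight a h0 i l.
Proof.
move=> [Vl hl]; set B := tight _ _ _ _ => ind; have hV := affine_space i.
have /choice[g hg] : forall b, exists g, V i g /\
    (b \in B -> forall j, j \in B -> g (a j) = (j == b)%:R).
  move=> b; have [bB|_] := boolP (b \in B); last first.
    by exists (cst 0); split=> //; exact: fs_cst hV 0.
  by have [g Vg gb] := dual_function hV ind bB; exists g.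
pose G j := \sum_b `|g b (a j)|.
pose s n : R := n.+1%:R^-1.
have s0 n : 0 <= s n by rewrite invr_ge0.
have s1 n j : s n ^+ j.+1 <= s n.
  rewrite exprS ler_piMr // exprn_ile1 // invf_le1 ?ltr0n //.
  by rewrite ler1n.
have [j|n0 hn] := @eventually_all 'I_N (fun j n => C i (a j) -> j \notin B ->
    s n * (G j + 1) < l (a j) - h0 j).
  have [[ij jB]|nj] := pselect (C i (a j) /\ j \notin B); last first.
    by exists 0%N => n _ ij jB; case: nj.
  have eta : 0 < l (a j) - h0 j.
    rewrite subr_gt0 lt_neqAle hl // andbT.
    by apply: contraNneq jB => e; apply/tightP.
  exists (Num.bound ((G j + 1) / (l (a j) - h0 j))) => n hn _ _.
  rewrite /s mulrC ltr_pdivrMr ?ltr0n // -ltr_pdivrMl //.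
  rewrite mulrC; apply: lt_le_trans (archi_boundP _) _.
    by apply: divr_ge0; [apply: addr_ge0 => //; exact: sumr_ge0|exact: ltW].
  by rewrite ler_nat ltnW.
exists n0 => n /hn{hn} hn.
pose u b := if b \in B then s n ^+ b.+1 else 0.
pose l' y := l y + \sum_b u b * g b y.
have Vl' : V i l'.
  by apply: (fs_add hV Vl); apply: (fs_sum hV) => b; case: (hg b).
have l'B j : j \in B -> l' (a j) = perturbed_height n j.
  move=> jB; have /tightP[_ lj] := jB; rewrite /l' lj; congr (_ + _).
  rewrite (bigD1 j) //= big1 ?addr0 => [|b bj].
    by rewrite /u jB; have [_ ->] := hg j; rewrite // eqxx mulr1.
  rewrite /u; case: ifP => [bB|_]; last by rewrite mul0r.
  by have [_ ->] := hg b; rewrite // eq_sym (negbTE bj) mulr0.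
have l'nB j : C i (a j) -> j \notin B -> perturbed_height n j < l' (a j).
  move=> ij jB; have := hn j ij jB.
  have : `|\sum_b u b * g b (a j)| <= s n * G j.
    apply: le_trans (ler_norm_sum _ _ _) _; rewrite mulr_sumr.
    apply: ler_sum => b _; rewrite normrM ler_wpM2r // /u.
    case: ifP => _; last by rewrite normr0.
    by rewrite ger0_norm ?s1 // exprn_ge0.
  rewrite ler_norml /l' /perturbed_height -/(s n) => /andP[ub _].
  by have := s1 n j; lra.
exists l'.
  split=> // j ij; have [jB|jB] := boolP (j \in B); first by rewrite l'B.
  exact: ltW (l'nB j ij jB).
apply/finset.setP => j; apply/idP/idP => [/tightP[ij e]|jB].
  by apply: contraT => jB; have := l'nB j ij jB; rewrite e ltxx.
by apply/tightP; split; [have /tightP[] := jB|exact: l'B].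
Qed.

End Perturbation.

(** * Simplices and concave functions *)

Section Simplices.
Context {R : realType} (D : integral_complex R).
Implicit Types (i m : pc_idx D) (x y z : pc_space D) (J : set (pc_idx D)).
Local Notation T := (pc_space D).
Local Notation C := (@pc_cell R D).
Local Notation V := (@pc_affine R D).

Lemma hull_in_generator i n (p : 'I_n -> T) r : C i (p r) ->
  hull_in (C i) (V i) p (p r).
Proof.
move=> Cp; split=> //; exists (fun l => (l == r)%:R); first exact: weights_delta.
by move=> f _; rewrite sum_delta.
Qed.

(** The vertex is the zero set of [1] minus its barycentric coordinate. *)
Lemma simplex_vertex_face i n (p : 'I_n -> T) r : (forall j, C i (p j)) ->
  affinely_independent (V i) p ->
  face_of (V i) [set p r] (hull_in (C i) (V i) p).
Proof.
move=> Cp ind; have hV := affine_space i.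
have [||f Vf fp] := @dual_function _ _ _ _ hV n [set: 'I_n]%SET p r.
- by move=> c _; exact: ind.
- by rewrite inE.
have {}fp j : f (p j) = (j == r)%:R by apply: fp; rewrite inE.
split; first by exists (p r).
exists (fun x => 1 - f x); first exact: (fs_sub hV (fs_cst hV 1) Vf).
have f1 x w : weights w -> combination (V i) p w x ->
    1 - f x = \sum_j w j * (1 - f (p j)).
  move=> [_ w1] cw; rewrite (cw _ Vf) -{1}w1 -sumrB; apply: eq_bigr => j _.
  by rewrite mulrBr mulr1.
have fle j : 0 <= 1 - f (p j) by rewrite fp subr_ge0 lern1 leq_b1.
split.
  move=> x [_ [w hw cw]]; rewrite (f1 x w) //; apply: sumr_ge0 => j _.
  by rewrite mulr_ge0 //; case: hw.
apply/seteqP; split=> [_ ->|x [[ix [w hw cw]] /= fx]].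
  by split; [exact: hull_in_generator|rewrite /= fp eqxx subrr].
apply: (cell_separated ix (Cp r)) => g Vg; rewrite (cw _ Vg).
have wr j : j != r -> w j = 0.
  move=> jr; apply/eqP; apply: contraT => wj.
  have := @weighted_sum_eq0 _ _ w (fun j => 1 - f (p j)) hw.1 _ _ j wj.
  rewrite -(f1 x w) // fp (negbTE jr) subr0 => /(_ (fun _ _ => fle _) fx) /eqP.
  by rewrite oner_eq0.
have w1 : w r = 1.
  by have := hw.2; rewrite (bigD1 r) //= big1 ?addr0.
rewrite (bigD1 r) //= w1 mul1r big1 ?addr0 // => j jr.
by rewrite wr ?mul0r.
Qed.

(** Jensen's inequality, from the definition of concavity with two points. *)
Lemma convex_down_jensen i f n (p : 'I_n -> T) w x : convex_down_on_cell i f ->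
  weights w -> (forall j, w j != 0 -> C i (p j)) -> C i x ->
  combination (V i) p w x -> \sum_j w j * f (p j) <= f x.
Proof.
move=> cvx; elim: n p w x => [|n IH] p w x [w0 w1] Cp ix cw.
  by have /eqP := w1; rewrite big_ord0 eq_sym oner_eq0.
pose q (j : 'I_n) := p (lift ord0 j); pose v (j : 'I_n) := w (lift ord0 j).
have sum_split (F : 'I_n.+1 -> R) : \sum_j w j * F j =
    w ord0 * F ord0 + \sum_j v j * F (lift ord0 j) by rewrite big_ord_recl.
have vs : \sum_j v j = 1 - w ord0.
  by rewrite -w1 big_ord_recl addrC addKr.
rewrite sum_split.
have [wo|wo] := eqVneq (w ord0) 0.
  rewrite wo mul0r add0r; apply: (IH q v x) => //.
  - by split=> [j|]; [exact: w0|rewrite vs wo subr0].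
  - by move=> j /Cp.
  - by move=> g Vg; rewrite (cw _ Vg) sum_split wo mul0r add0r.
have po := Cp _ wo.
have [wo1|wo1] := eqVneq (w ord0) 1.
  have v0 j : v j = 0.
    have /eqP : \sum_j v j = 0 by rewrite vs wo1 subrr.
    rewrite psumr_eq0 => [/allP/(_ j (mem_index_enum j))/eqP //|j' _].
    exact: w0.
  suff -> : x = p ord0.
    by rewrite wo1 mul1r big1 ?addr0 // => j _; rewrite v0 mul0r.
  apply: (cell_separated ix po) => g Vg; rewrite (cw _ Vg) sum_split wo1 mul1r.
  by rewrite big1 ?addr0 // => j _; rewrite v0 mul0r.
have d0 : 0 < 1 - w ord0.
  have : w ord0 <= 1 by rewrite -w1 big_ord_recl lerDl sumr_ge0.
  by rewrite le_eqVlt (negbTE wo1) subr_gt0.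
pose u j := (1 - w ord0)^-1 * v j.
have hu : weights u.
  split=> [j|]; first by rewrite mulr_ge0 ?invr_ge0 ?(ltW d0) //; exact: w0.
  by rewrite -mulr_sumr vs mulVf ?gt_eqF.
have uq j : u j != 0 -> C i (q j).
  by rewrite mulf_eq0 => /norP[_ /Cp].
have [y iy cy] := cell_convex hu uq.
have su F : (1 - w ord0) * \sum_j u j * F j = \sum_j v j * F j.
  rewrite mulr_sumr; apply: eq_bigr => j _.
  by rewrite /u -mulrA mulVKf ?gt_eqF.
have := IH q u y hu uq iy cy.
rewrite -(ler_pM2l d0) su => h1.
apply: le_trans (cvx (p ord0) y x (w ord0) (1 - w ord0) po iy ix _ (ltW d0) _ _).
- by rewrite lerD2l.
- exact: w0.
- by rewrite addrC subrK.
- by move=> g Vg; rewrite (cw _ Vg) sum_split (cy _ Vg) su.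
Qed.

Lemma finite_Sk0 (S : set (set T)) : finite_set S -> finite_set (Sk0 S).
Proof.
move=> fS; apply: (@finite_preimage _ _ S (fun x : T => [set x])) => //.
by move=> x y _ _ e; have : [set y] x by rewrite -e.
Qed.

Lemma finite_marking (A : set T) : finite_set A ->
  exists N (a : 'I_N -> T), injective a /\ range a = A.
Proof.
move=> /finite_seqP[s ->]; exists (size (undup s)), (tnth (in_tuple (undup s))).
split; first by apply/tuple_uniqP; exact: undup_uniq.
apply/seteqP; split=> x /=.
  by move=> [j _ <-]; rewrite -mem_undup; exact: mem_tnth.
rewrite -mem_undup => /(tnthP (in_tuple (undup s)))[j ->].
by exists j.
Qed.

End Simplices.

(** * Extension of the triangulation *)

Section Extension.
Context {R : realType} (D : integral_complex R) (J : set (pc_idx D)).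
Context (S0 : set (set (pc_space D))) (f0 : pc_space D -> R).
Context (N : nat) (a : 'I_N -> pc_space D).
Implicit Types (i m : pc_idx D) (x y z : pc_space D).
Local Notation T := (pc_space D).
Local Notation C := (@pc_cell R D).
Local Notation V := (@pc_affine R D).

Hypothesis hS0 : triangulation J S0.
Hypothesis hf0 : lifting_function J f0.
Hypothesis hind : induced_by J S0 f0.
Hypothesis a_inj : injective a.
Hypothesis a_range : range a = Sk0 (pc_cells setT) `|` Sk0 S0.

Let vertices_marked m x : C m = [set x] -> exists j, a j = x.
Proof.
move=> Em; have : range a x by rewrite a_range; left; exists m.
by move=> [j _ <-]; exists j.
Qed.

Let marked_cases j : (exists m, C m = [set a j]) \/ S0 [set a j].
Proof.
have : range a (a j) by exists j.
by rewrite a_range => -[[m _ Em]|]; [left; exists m|right].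
Qed.

Let marked_rational i j : C i (a j) -> rational_point i (a j).
Proof.
move=> ij; have [[m Em]|Sj] := marked_cases j; first exact: rational_vertex Em ij.
have [[_ rp _ _ _] _] := hS0; have [m _ [n [p [rpp E]]]] := rp _ Sj.
have pa : p ord0 = a j.
  suff : [set a j] (p ord0) by [].
  by rewrite E; apply: hull_in_generator; case: (rpp ord0).
by apply: (@rational_point_transfer _ _ m) => //; rewrite -pa.
Qed.

(** A vertex of the complex that lies in [J] is a vertex of [S0]: being
    a face of its cell, it is a face of every cell of [S0] that contains it. *)
Let marked_in_S0 i j : J i -> C i (a j) -> S0 [set a j].
Proof.
move=> Ji ij; have [[m Em]|//] := marked_cases j.
have [[_ _ face _ cov] _] := hS0.
have : polyhedron J (a j) by exists i.
rewrite -cov => -[t St tj]; have [i' [Ji' ti' _]] := subdivision_cell hS0.1 St.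
apply: (face i' t) => //.
have [_ [k Vk [k0 E]]] := vertex_face Em (ti' _ tj).
split; first by exists (a j).
exists k => //; split=> [x tx|]; first by apply: k0; exact: ti'.
rewrite Em in E; apply/seteqP; split=> [_ ->|x [tx kx]].
  have : [set a j] (a j) by [].
  by rewrite E => -[].
by rewrite E; split=> //; exact: ti'.
Qed.

(** Outside the subcomplex any rational height serves. *)
Definition base_height (j : 'I_N) : R :=
  if `[< polyhedron J (a j) >] then f0 (a j) else 0.

Let base_heightE i j : J i -> C i (a j) -> base_height j = f0 (a j).
Proof. by move=> Ji ij; rewrite /base_height asboolT //; exists i. Qed.

Let base_height_rational j : rational (base_height j).
Proof.
rewrite /base_height; case: asboolP => [[i Ji ij]|_].
  by have [_ _ _ rat] := hf0; apply: (rat i) => //; exact: marked_rational.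
by exists 0 => //; rewrite rmorph0.
Qed.

Let S0_simplex t : S0 t -> exists i n (p : 'I_n.+1 -> T),
  [/\ J i, forall r, C i (p r), affinely_independent (V i) p,
      t = hull_in (C i) (V i) p & forall r, S0 [set p r]].
Proof.
move=> St; have [[_ _ face _ _] simp] := hS0.
have [i Ji [n [p [ip ind tE]]]] := simp t St.
exists i, n, p; split=> // r; apply: (face i t) => //.
  by rewrite tE => x [].
by rewrite tE; exact: simplex_vertex_face.
Qed.

(** Concavity bounds the hull of the heights of [f0] by [f0]; on a simplex of
    [S0], whose vertices are marked, [f0] is affine, hence at most the hull. *)
Let hull_base_height i x : J i -> C i x -> f0 x = hull_height a base_height x.
Proof.
move=> Ji ix; apply/eqP; rewrite eq_le; apply/andP; split; last first.
  have [[w [hw wC cw] <-] _] := hull_heightP base_height vertices_marked ix.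
  have -> : \sum_j w j * base_height j = \sum_j w j * f0 (a j).
    apply: eq_bigr => j _; have [->|/wC ij] := eqVneq (w j) 0.
      by rewrite !mul0r.
    by rewrite (base_heightE Ji).
  by have [_ _ cvx _] := hf0; exact: convex_down_jensen (cvx i Ji) hw wC ix cw.
have [[_ _ _ _ cov] _] := hS0.
have : polyhedron J x by exists i.
rewrite -cov => -[t St tx].
have [m [n [p [Jm mp ind tE pS0]]]] := S0_simplex St.
have [tm [x0 inn]] : t `<=` C m /\ exists x, inner_point (V m) t x.
  by apply: polytope_inner_point; exists n, p.
have [_ lin _] := hind; have [i' [Ji' ti' [g' Vg' fg']]] := lin t St.
have [g Vg gg'] := affine_transfer tm inn (ti' _ inn.1) Vg'.
have fg y : t y -> f0 y = g y by move=> ty; rewrite fg' // gg'.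
have [mx [w [w0 w1] cw]] : hull_in (C m) (V m) p x by rewrite -tE.
have [_ [l [Vl ml] <-]] := hull_heightP base_height vertices_marked mx.
rewrite fg // (cw _ Vg) (cw _ Vl); apply: ler_sum => r _.
rewrite ler_wpM2l // -fg; last by rewrite tE; exact: hull_in_generator.
have [j pr] : exists j, a j = p r.
  have : range a (p r) by rewrite a_range; right; exact: pS0.
  by move=> [j _ <-]; exists j.
have mj : C m (a j) by rewrite pr.
by rewrite -pr -(base_heightE Jm mj); exact: ml.
Qed.

Let S0_hull_cells : S0 = hull_cells a base_height J.
Proof.
have dS0 := hS0.1.
have dH := hull_subdivision base_height vertices_marked marked_rational J.
have [_ lin coarse] := hind.
have r1 : subdivision_refines S0 (hull_cells a base_height J).
  apply: (linear_subdivision_refines vertices_marked) => //.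
  by apply: linear_on_cells_eq lin => i x; exact: hull_base_height.
have r2 : subdivision_refines (hull_cells a base_height J) S0.
  apply: coarse => //.
  apply: linear_on_cells_eq (@hull_cells_linear _ _ _ a base_height J).
  by move=> i x Ji ix; rewrite (hull_base_height Ji).
by apply/seteqP; split; [exact: (mutual_refinement dS0 dH)|exact: (mutual_refinement dH dS0)].
Qed.

(** Each tight marked point of a cell of [S0] is a vertex of this simplex. *)
Let base_tight_independent i l : J i -> majorant a base_height i l ->
  independent_on (V i) (tight a base_height i l) a.
Proof.
move=> Ji ml; set B := tight _ _ _ _; pose t := contact a base_height i l.
have Bt j : j \in B -> t (a j).
  by move=> /tightP[ij lj]; exact: (tight_contact vertices_marked).
move=> c cB cann b; apply/eqP; apply: contraT => cb.
have bB : b \in B by apply: contraNT cb => /cB ->.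
have ne : t !=set0 by exists (a b); exact: Bt.
have St : S0 t by rewrite S0_hull_cells; split=> //; exists i, l.
have [m [n [p [Jm mp ind tE _]]]] := S0_simplex St.
have tm : t `<=` C m by rewrite tE => x [].
have [x0 inn] := contact_inner_point vertices_marked marked_rational ml ne.
have /choice[rho hrho] : forall j, exists r, j \in B -> p r = a j.
  move=> j; have [jB|_] := boolP (j \in B); last by exists ord0.
  have tj := Bt j jB; have Sj : S0 [set a j] by apply: (marked_in_S0 Ji); exact: tj.1.
  have [[_ _ _ meet _] _] := hS0.
  have tI : t `&` [set a j] = [set a j].
    by apply/seteqP; split=> [x []|_ ->].
  have [|||+ _] := meet m t [set a j] Jm St Sj => //.
  - by move=> _ ->; exact: tm.
  - by rewrite tI; exists (a j).
  rewrite tI => -[_ [k Vk [k0 kE]]].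
  have [_ [w [w0 w1] cw]] : hull_in (C m) (V m) p (a j) by rewrite -tE.
  have tp r : t (p r) by rewrite tE; exact: hull_in_generator.
  have kj : k (a j) = 0.
    have : [set a j] (a j) by [].
    by rewrite kE => -[].
  have [r wr] : exists r, w r != 0.
    apply: contrapT => nw; have : \sum_r w r = 0.
      apply: big1 => r _; apply/eqP; apply: contraT => wr.
      by case: nw; exists r.
    by rewrite w1 => /eqP; rewrite oner_eq0.
  exists r => _; suff : [set a j] (p r) by [].
  rewrite kE; split=> //=.
  apply: (@weighted_sum_eq0 _ _ w (fun r => k (p r))) => //.
    by move=> r' _; exact: k0.
  by rewrite -(cw _ Vk).
pose d r := \sum_j c j * (rho j == r)%:R.
have d0 r : d r = 0.
  apply: ind => f Vf.
  have [g Vg fg] := affine_transfer (@contact_sub _ _ _ a base_height i l) inn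
    (tm _ inn.1) Vf.
  transitivity (\sum_j c j * g (a j)); last exact: cann.
  under eq_bigr do rewrite mulr_suml.
  rewrite exchange_big /=; apply: eq_bigr => j _.
  have [jB|/cB ->] := boolP (j \in B); last first.
    by rewrite mul0r; apply: big1 => r' _; rewrite !mul0r.
  rewrite (bigD1 (rho j)) //= eqxx mulr1 big1 ?addr0; last first.
    by move=> r' /negbTE; rewrite eq_sym => ->; rewrite mulr0 mul0r.
  by rewrite hrho // fg //; exact: Bt.
have := d0 (rho b); rewrite /d (bigD1 b) //= eqxx mulr1 big1 ?addr0.
  by move=> cb0; rewrite cb0 eqxx in cb.
move=> j jb; have [jB|/cB ->] := boolP (j \in B); last by rewrite mul0r.
case: eqP => [e|]; last by rewrite mulr0.
by case/eqP: jb; apply: a_inj; rewrite -hrho // e hrho.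
Qed.

(** Every simplex of [S0] is a contact set for the perturbed heights, with the
    same tight points as before, once the perturbation is small. *)
Lemma base_cells_stable : exists n0, forall n, (n0 <= n)%N ->
  hull_cells a (perturbed_height base_height n) J = S0.
Proof.
have [iB|n0 hn] := @eventually_all (pc_idx D * {set 'I_N})%type (fun iB n =>
    J iB.1 -> forall l, majorant a base_height iB.1 l ->
    tight a base_height iB.1 l = iB.2 ->
    exists2 l', majorant a (perturbed_height base_height n) iB.1 l' &
      tight a (perturbed_height base_height n) iB.1 l' = iB.2).
  case: iB => i B /=.
  have [[l [Ji ml tB]]|nl] := pselect (exists l,
      [/\ J i, majorant a base_height i l & tight a base_height i l = B]).
    have [n0 hn] := tight_stable ml (base_tight_independent Ji ml).
    by exists n0 => n /hn[l' ml' tl'] _ _ _ _; exists l' => //; rewrite tl'.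
  by exists 0%N => n _ Ji l ml tB; case: nl; exists l.
exists n0 => n /hn{hn} hn.
set h := perturbed_height base_height n.
apply/esym; apply: (subdivision_sub_eq hS0.1).
  exact: (hull_subdivision h vertices_marked marked_rational J).
rewrite S0_hull_cells => t [ne [i [l [Ji ml tE]]]].
have [l' ml' tl'] := hn (i, tight a base_height i l) Ji l ml erefl.
split=> //; exists i, l'; split=> //.
rewrite tE (contact_hull vertices_marked ml).
by rewrite (contact_hull vertices_marked ml') tl'.
Qed.

Lemma extension_exists :
  exists (S : set (set (pc_space D))) (f : pc_space D -> R),
    [/\ triangulation setT S, lifting_function setT f, induced_by setT S f,
        subdivision_restriction S J = S0 &
        Sk0 S = Sk0 (pc_cells setT) `|` Sk0 S0].
Proof.
have [n0 stable] := base_cells_stable.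
have [n /stable nS0 generic] := perturbed_generic a base_height n0.
set h := perturbed_height base_height n in nS0 generic.
have sT := hull_subdivision h vertices_marked marked_rational setT.
exists (hull_cells a h setT), (hull_height a h); split.
- split=> // t [ne [i [l [_ ml tE]]]]; exists i => //.
  rewrite tE; apply: (contact_simplex vertices_marked ml) (generic i l ml).
  by rewrite -tE.
- split.
  + exact: hull_continuous.
  + by move=> i _; exact: hull_piecewise_linear.
  + by move=> i _; exact: hull_convex_down.
  + move=> i x _; apply: hull_height_rational => //.
    * exact: (perturbed_height_rational n base_height_rational).
    * exact: generic.
- exact: hull_induced.
- rewrite -nS0; apply/seteqP; split=> t.
    move=> [St [i Ji ti]]; split; first by case: St.
    have [l ml ->] := hull_cells_in vertices_marked marked_rational St ti.
    by exists i, l.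
  move=> [ne [i [l [Ji ml tE]]]]; split; first by split=> //; exists i, l.
  by exists i => //; rewrite tE; exact: contact_sub.
rewrite -a_range; apply/seteqP; split=> x.
  move=> [_ [i [l [_ ml tE]]]].
  have : contact a h i l x by rewrite -tE.
  rewrite (contact_hull vertices_marked ml) => /marked_hull_neq0.
  move=> /set0Pn[j /tightP[ij lj]].
  have : [set x] (a j) by rewrite tE; exact: (tight_contact vertices_marked).
  by move=> <-; exists j.
rewrite a_range => -[[m _ Em]|].
  have mx : C m x by rewrite Em.
  have [_ [l ml lx]] := hull_heightP h vertices_marked mx.
  split; first by exists x.
  exists m, l; split=> //; apply/seteqP; split=> [_ ->|y []].
    by split.
  by rewrite Em.
rewrite -nS0 => -[ne [i [l [_ ml tE]]]].
by split=> //; exists i, l.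
Qed.

End Extension.

Theorem theorem0p10 (R : realType) (D : integral_complex R)
    (J : set (pc_idx D)) (hJ : subcomplex J)
    (S0 : set (set (pc_space D))) (hS0 : triangulation J S0)
    (f0 : pc_space D -> R) (hf0 : lifting_function J f0)
    (hS0f0 : induced_by J S0 f0) :
  exists (S : set (set (pc_space D))) (f : pc_space D -> R),
    [/\ triangulation setT S,
        lifting_function setT f,
        induced_by setT S f,
        subdivision_restriction S J = S0 &
        Sk0 S = Sk0 (pc_cells setT) `|` Sk0 S0].
Proof.
have [|N [a [a_inj a_range]]] :=
  @finite_marking _ _ (Sk0 (pc_cells setT) `|` Sk0 S0 : set (pc_space D)).
  rewrite finite_setU; split; apply: finite_Sk0; last by case: hS0 => -[].
  by apply: finite_image; exact: finite_finset.
exact: (extension_exists hS0 hf0 hS0f0 a_inj a_range).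
Qed.
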